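(* (1) Let $\beta>0$. Then $$D_{\beta,\beta}=\min\Big\{\inf_{\theta\in[\eta^{-1}(\beta),\psi^{-1}(\beta)]}\Lambda^+_{\beta,\beta}(\theta),\ \inf_{\theta\in[\eta^{-1}(\beta),\psi^{-1}(\beta))}\Lambda^-_{\beta,\beta}(\theta)\Big\}.$$ (2) Let $\gamma>\beta>0$. Then $$D_{\beta,\gamma}=\min\Big\{\inf_{\theta\in[\eta_\gamma^{-1}(\beta),\psi^{-1}(\beta)]}\Lambda^+_{\beta,\gamma}(\theta),\ \inf_{\theta\in[\eta_\gamma^{-1}(\beta),\psi^{-1}(\gamma))}\Lambda^-_{\beta,\gamma}(\theta)\Big\}.$$ (3) Let $\gamma>0$. Then $D_{0,\gamma}=\inf_{\theta\in[0,\psi^{-1}(\gamma))}\Lambda^-_{0,\gamma}(\theta)$. (4) Let $\beta>\gamma>0$. Then $$D_{\beta,\gamma}=\min\Big\{\inf_{\theta\in[\eta_\beta^{-1}(\gamma),\psi^{-1}(\beta)]}\Lambda^+_{\beta,\gamma}(\theta),\ \inf_{\theta\in[\eta_\beta^{-1}(\gamma),\psi^{-1}(\gamma))}\Lambda^-_{\beta,\gamma}(\theta)\Big\}.$$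
   Context: Let $\mathcal{H}=\{(x,v)\in\mathbb{R}^2:v\ge0\}$, $d_H$ the Riemannian distance on $\mathcal{H}$ induced by $ds^2=v^{-1}(dx^2+dv^2)$ on the open upper half-plane (extended to the boundary), and $D_{\beta,\gamma}=\inf_{v\ge0}\frac12 d_H((0,1),(\beta+\gamma v,v))^2$. Define $\psi(\theta)=\frac{\theta-\sin\theta}{1-\cos\theta}$, $A(\theta)=\frac{\theta\cos\frac\theta2-2\sin\frac\theta2}{\theta-\sin\theta}$, $B(\theta)=\frac{1-\cos\theta}{\theta-\sin\theta}$. $\psi$ is a strictly increasing bijection $(0,2\pi)\to(0,\infty)$ with inverse $\psi^{-1}$. $\eta(\theta)=\psi(\theta)(1-A(\theta))$ is a strictly increasing bijection $(0,2\pi)\to(0,\infty)$ with inverse $\eta^{-1}$. For $\alpha>0$, $\eta_\alpha(\theta)=\frac{\psi(\theta)^2A(\theta)^2}{\alpha-\psi(\theta)}+\psi(\theta)$ on $(0,\psi^{-1}(\alpha))$ is strictly increasing, tends to $0$ as $\theta\downarrow0$ and to $\infty$ as $\theta\uparrow\psi^{-1}(\alpha)$; $\eta_\alpha^{-1}$ is its inverse. When $1-\gamma B(\theta)\ne0$, set $$S^\pm_{\beta,\gamma}(\theta)=\frac{A(\theta)\pm\sqrt{A(\theta)^2-(1-\gamma B(\theta))(1-\beta B(\theta))}}{1-\gamma B(\theta)},$$ and when $1-\gamma B(\theta)=0$ set $S^+_{\beta,\gamma}(\theta)=\frac{1-\beta B(\theta)}{2A(\theta)}$ (the limit of $S^+_{\beta,\gamma}$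 there). Define $$\Lambda^\pm_{\beta,\gamma}(\theta)=\frac{\theta^2}{1-\cos\theta}\Big(S^\pm_{\beta,\gamma}(\theta)^2+1-2S^\pm_{\beta,\gamma}(\theta)\cos\tfrac\theta2\Big),$$ the value at $\theta=0$ being understood as the limit as $\theta\downarrow0$. *)

(* Defs.v *)
From mathcomp Require Import all_boot all_order all_algebra.
From mathcomp Require Import all_classical all_reals all_analysis.
Import Order.TTheory GRing.Theory Num.Theory.
Import numFieldNormedType.Exports.
Local Open Scope classical_set_scope.
Local Open Scope ring_scope.

Set Implicit Arguments.
Unset Strict Implicit.
Unset Printing Implicit Defensive.

Definition psi {R : realType} (t : R) : R := (t - sin t) / (1 - cos t).
Definition Afun {R : realType} (t : R) : R :=
  (t * cos (t / 2) - 2 * sin (t / 2)) / (t - sin t).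
Definition Bfun {R : realType} (t : R) : R := (1 - cos t) / (t - sin t).
Definition eta {R : realType} (t : R) : R := psi t * (1 - Afun t).
Definition eta_al {R : realType} (al t : R) : R :=
  (psi t ^+ 2 * Afun t ^+ 2) / (al - psi t) + psi t.

Definition psi_inv {R : realType} (y : R) : R :=
  get [set t : R | 0 < t < 2 * pi /\ psi t = y].
Definition eta_inv {R : realType} (y : R) : R :=
  get [set t : R | 0 < t < 2 * pi /\ eta t = y].
Definition eta_al_inv {R : realType} (al y : R) : R :=
  get [set t : R | 0 < t < psi_inv al /\ eta_al al t = y].

Definition S_plus {R : realType} (b g t : R) : R :=
  let d := 1 - g * Bfun t in
  if d == 0 then (1 - b * Bfun t) / (2 * Afun t)
  else (Afun t + Num.sqrt (Afun t ^+ 2 - d * (1 - b * Bfun t))) / d.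
(* S^- is only defined by the paper when 1 - g B(t) <> 0; at such a point
   the formula below evaluates to an irrelevant value (x / 0 = 0). *)
Definition S_minus {R : realType} (b g t : R) : R :=
  let d := 1 - g * Bfun t in
  (Afun t - Num.sqrt (Afun t ^+ 2 - d * (1 - b * Bfun t))) / d.

Definition Lam_raw {R : realType} (S : R -> R) (t : R) : R :=
  t ^+ 2 / (1 - cos t) * (S t ^+ 2 + 1 - 2 * S t * cos (t / 2)).

Definition Lambda_plus {R : realType} (b g t : R) : R :=
  if t == 0 then lim (Lam_raw (S_plus b g) @ 0^'+)
  else Lam_raw (S_plus b g) t.
Definition Lambda_minus {R : realType} (b g t : R) : R :=
  if t == 0 then lim (Lam_raw (S_minus b g) @ 0^'+)
  else Lam_raw (S_minus b g) t.

Definition adm_path {R : realType} (p q : R * R) (x v : R -> R) : Prop :=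
  [/\ (x 0, v 0) = p, (x 1, v 1) = q,
      ({within `[0, 1], continuous x}),
      ({within `[0, 1], continuous v}) &
      forall t : R, 0 < t < 1 ->
        [/\ derivable x t 1, derivable v t 1 & 0 < v t]].

(* Riemannian length for ds^2 = v^{-1} (dx^2 + dv^2) *)
Definition path_length {R : realType} (x v : R -> R) : \bar R :=
  (\int[@lebesgue_measure R]_(t in `[0%R, 1%R]%classic)
     (Num.sqrt ((derive1 x t ^+ 2 + derive1 v t ^+ 2) / v t))%:E)%E.

Definition dH {R : realType} (p q : R * R) : \bar R :=
  ereal_inf [set l | exists x v, adm_path p q x v /\ l = path_length x v].

Definition Dbg {R : realType} (b g : R) : \bar R :=
  ereal_inf [set ((2^-1)%:E * (dH (0%R, 1%R) ((b + g * w)%R, w)) ^+ 2)%E | w in [set w : R | 0 <= w]].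

(* Main.v *)
(** With [r = sqrt v] the metric becomes [4 dr^2 + dx^2 / r^2], of Grushin type, whose
    geodesics have [r] sinusoidal in the arc length, so that [x] and [v = r^2] describe a
    cycloid.  The one from [(0, 1)] to [(x, s^2)] sweeping the angle [theta = 2 w] satisfies
    [x = psi(theta) (1 + s^2 - 2 A(theta) s)] and has squared length [2 Lambda].

    It is minimizing by calibration.  The energy [4 r'^2 + x'^2 / r^2] has Hamilton-Jacobi
    solutions [u(tau, x, r) = 4 w x + a(tau) r^2 + b(tau) r + c(tau)], smooth for [w < pi]; for
    one of them the increment of [u] between the end points is exactly the squared length.
    Admissible paths are only differentiable, with a merely measurable speed, so to bound the
    increment of [u] along a path by the square of its length we reparametrize time with the
    primitive of a lower semicontinuous majorant of the speed (Vitali-Caratheodory), for which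
    the inequality holds on small increments to the right of every point.

    On the line [x = beta + gamma s^2] the relation above is quadratic in [s]:
    [(psi - gamma) s^2 + 2 P s + (psi - beta) = 0] with [P = - psi A > 0].  Its nonnegative
    roots are [S^+] when [psi <= beta] and [S^-] when [psi < gamma], provided the discriminant
    is nonnegative, and [eta], [eta_alpha] delimit the angles for which it is. *)
Require Import Defs.
From mathcomp Require Import all_boot all_order all_algebra.
From mathcomp Require Import all_classical all_reals all_analysis.
From mathcomp Require Import measurable_realfun ring lra.
Import Order.TTheory GRing.Theory Num.Theory.
Import numFieldNormedType.Exports.
Local Open Scope classical_set_scope.
Local Open Scope ring_scope.
Set Implicit Arguments.
Unset Strict Implicit.
Unset Printing Implicit Defensive.

Section pointwise_derivatives.
Context {R : realType}.
Implicit Types (f g : R -> R) (x a b : R).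

(* Not a type class, unlike [is_derive], so that instance search does not interfere. *)
Definition has_der x f a : Prop := is_derive x 1 f a.

Lemma derC x (c : R) : has_der x (fun _ : R => c) 0.
Proof. exact: is_derive_cst. Qed.

Lemma derI x : has_der x (fun t : R => t) 1.
Proof. exact: is_derive_id. Qed.

Lemma derD f g x a b : has_der x f a -> has_der x g b ->
  has_der x (fun t => f t + g t) (a + b).
Proof. exact: is_deriveD. Qed.

Lemma derN f x a : has_der x f a -> has_der x (fun t => - f t) (- a).
Proof. exact: is_deriveN. Qed.

Lemma derM f g x a b : has_der x f a -> has_der x g b ->
  has_der x (fun t => f t * g t) (f x * b + g x * a).
Proof. exact: is_deriveM. Qed.

Lemma derX f n x a : has_der x f a ->
  has_der x (fun t => f t ^+ n) (n%:R * f x ^+ n.-1 * a).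
Proof.
move=> fa; have -> : (fun t => f t ^+ n) = f ^+ n.
  by apply/funext => t; elim: n => [|n ih]; rewrite ?expr0// !exprS ih.
exact: is_deriveX.
Qed.

Lemma derV f x a : has_der x f a -> f x != 0 ->
  has_der x (fun t => (f t)^-1) (- f x ^- 2 * a).
Proof. by move=> fa fx; exact: is_deriveV. Qed.

Lemma der_sin f x a : has_der x f a ->
  has_der x (fun t => sin (f t)) (cos (f x) * a).
Proof. by move=> fa; exact: (@is_derive1_comp _ _ f). Qed.

Lemma der_cos f x a : has_der x f a ->
  has_der x (fun t => cos (f t)) (- sin (f x) * a).
Proof. by move=> fa; exact: (@is_derive1_comp _ _ f). Qed.

Lemma der_sqrt f x a : has_der x f a -> 0 < f x ->
  has_der x (fun t => Num.sqrt (f t)) ((2 * Num.sqrt (f x))^-1 * a).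
Proof.
by move=> fa fx; exact: (@is_derive1_comp _ Num.sqrt f x _ _ (is_derive1_sqrt fx) fa).
Qed.

Lemma der_continuous f x a : is_derive x 1 f a -> {for x, continuous f}.
Proof. by case=> /derivable1_diffP/differentiable_continuous. Qed.

Lemma MVT_der f (df : R -> R) a b : a < b ->
  (forall x, is_derive x 1 f (df x)) ->
  exists2 c, a < c < b & f b - f a = df c * (b - a).
Proof.
move=> ab fd; have [|c] := @MVT R f df a b ab.
- by apply: continuous_in_subspaceT => z _; exact: der_continuous (fd z).
- by rewrite in_itv/= => cab e; exists c.
Qed.

Lemma der_gt0_homo f (df : R -> R) a b :
  (forall x, a < x < b -> is_derive x 1 f (df x)) ->
  (forall x, a < x < b -> 0 < df x) ->
  forall x y, a < x -> x < y -> y < b -> f x < f y.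
Proof.
move=> fd df0 x y ax xy yb.
have [||z] := @MVT R f df x y xy.
- move=> z; rewrite in_itv/= => /andP[xz zy]; apply: fd.
  by rewrite (lt_trans ax xz) (lt_trans zy yb).
- apply: continuous_in_subspaceT => z; rewrite inE/= in_itv/= => /andP[xz zy].
  apply: der_continuous; apply: fd.
  by rewrite (lt_le_trans ax xz) (le_lt_trans zy yb).
- rewrite in_itv/= => /andP[xz zy] e; rewrite -subr_gt0 e mulr_gt0 ?subr_gt0//.
  by apply: df0; rewrite (lt_trans ax xz) (lt_trans zy yb).
Qed.

Lemma IVT_oo f a b c d v : a < c -> c <= d -> d < b ->
  (forall x, a < x < b -> {for x, continuous f}) ->
  f c <= v <= f d -> exists2 x, c <= x <= d & f x = v.
Proof.
move=> ac cd db fc /andP[fv vf].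
have [||x] := @IVT R f c d v cd.
- apply: continuous_in_subspaceT => z; rewrite inE/= in_itv/= => /andP[xz zy].
  by apply: fc; rewrite (lt_le_trans ac xz) (le_lt_trans zy db).
- by rewrite ge_min fv le_max vf orbT.
- by rewrite in_itv/= => xcd e; exists x.
Qed.

End pointwise_derivatives.

Ltac der1 := first
  [ exact: derC | exact: derI | apply: derD | apply: derN | apply: derX
  | apply: derM | apply: derV | apply: der_sin | apply: der_cos | apply: der_sqrt ].
Lemma der_eq {R : realType} (f : R -> R) (x a b : R) :
  has_der x f a -> a = b -> is_derive x 1 f b.
Proof. by move=> fa <-. Qed.

Ltac der := apply: der_eq; [ repeat der1 | rewrite /= ].

Section cycloid_functions.
Context {R : realType}.
Implicit Types w t : R.

(* [cpsi w] and [cphi w] are [psi] and [- psi A] at [theta = 2 w]. *)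
Definition cpsi w := (w - sin w * cos w) / sin w ^+ 2.
Definition cphi w := (sin w - w * cos w) / sin w ^+ 2.

Lemma sin_lt_id w : 0 < w -> sin w < w.
Proof.
move=> w0; have [w2|w2] := ltP w pi; last first.
  by rewrite (le_lt_trans (sin_le1 w))// (lt_le_trans _ w2)// (lt_le_trans _ (pi_ge2 R))// ltr1n.
have d (x : R) : is_derive x 1 (fun t => t - sin t) (1 - cos x) by der; rewrite mulr1.
have [c /andP[c0 cw]] := MVT_der w0 d; rewrite sin0 !subr0 => e.
rewrite -subr_gt0 e mulr_gt0// subr_gt0 -cos0 ltr_cos ?in_itv/= ?lexx ?pi_ge0//.
  rewrite (ltW c0); exact: ltW (lt_trans cw w2).
Qed.

Lemma mul_cos_lt_sin w : 0 < w -> w < pi -> w * cos w < sin w.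
Proof.
move=> w0 w2.
have d (x : R) : is_derive x 1 (fun t => sin t - t * cos t) (x * sin x) by der; ring.
have [c /andP[c0 cw]] := MVT_der w0 d; rewrite sin0 mul0r !subr0 => e.
rewrite -subr_gt0 e !mulr_gt0// sin_gt0_pi// c0/=.
  exact: lt_trans cw w2.
Qed.

Lemma der_cpsi w : 0 < w < pi ->
  is_derive w 1 cpsi (2 * (sin w - w * cos w) / sin w ^+ 3).
Proof.
move=> w0; have s0 := sin_gt0_pi w0.
rewrite /cpsi; der; first by rewrite expf_neq0// gt_eqF.
have := cos2Dsin2 w; set c := cos w; set s := sin w => h /=.
have -> : 1 - (s * (- s * 1) + c * (c * 1)) = 2 * s ^+ 2 by lra.
have -> : 2 * (s - w * c) = 2 * (s * (c ^+ 2 + s ^+ 2) - w * c) by rewrite h mulr1.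
by field; rewrite gt_eqF.
Qed.

Lemma der_cphi w : 0 < w < pi ->
  is_derive w 1 cphi ((w * (1 + cos w ^+ 2) - 2 * sin w * cos w) / sin w ^+ 3).
Proof.
move=> w0; have s0 := sin_gt0_pi w0.
rewrite /cphi; der; first by rewrite expf_neq0// gt_eqF.
have h := cos2Dsin2 w; set c := cos w in h *; set s := sin w in s0 h *.
have -> : 1 + c ^+ 2 = s ^+ 2 + 2 * c ^+ 2 by lra.
by field; rewrite gt_eqF.
Qed.

Lemma cpsi_homo w t : 0 < w -> w < t -> t < pi -> cpsi w < cpsi t.
Proof.
apply: der_gt0_homo der_cpsi _ _ _ => x /andP[x0 xp].
by rewrite divr_gt0 ?exprn_gt0 ?sin_gt0_pi ?x0// mulr_gt0// subr_gt0 mul_cos_lt_sin.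
Qed.

Lemma cphi_homo w t : 0 < w -> w < t -> t < pi -> cphi w < cphi t.
Proof.
apply: der_gt0_homo der_cphi _ _ _ => x /andP[x0 xp].
have s0 : 0 < sin x by rewrite sin_gt0_pi// x0.
rewrite divr_gt0 ?exprn_gt0// subr_gt0.
have [c0|c0] := leP (cos x) 0.
  rewrite (@le_lt_trans _ _ 0)//; last by rewrite mulr_gt0// ltr_pwDl// sqr_ge0.
  by rewrite mulr_ge0_le0// mulr_ge0// ltW.
have := sin_lt_id x0; have := sqr_ge0 (1 - cos x); nra.
Qed.

Lemma cphi_gt0 w : 0 < w < pi -> 0 < cphi w.
Proof.
move=> /andP[w0 wp].
by rewrite divr_gt0 ?exprn_gt0 ?sin_gt0_pi ?w0// subr_gt0 mul_cos_lt_sin.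
Qed.

Lemma cphi_lt_cpsi w : 0 < w < pi -> cphi w < cpsi w.
Proof.
move=> wp; have /andP[w0 wpi] := wp; have s0 := sin_gt0_pi wp.
rewrite ltr_pM2r ?invr_gt0 ?exprn_gt0//.
have c1 : -1 < cos w.
  by rewrite -cospi ltr_cos// in_itv/= ?lexx ?pi_ge0// (ltW w0) (ltW wpi).
by have := sin_lt_id w0; nra.
Qed.

Lemma cpsi_gt0 w : 0 < w < pi -> 0 < cpsi w.
Proof. by move=> wp; rewrite (lt_trans (cphi_gt0 wp)) ?cphi_lt_cpsi. Qed.

Lemma cpsi_small e : 0 < e -> exists2 w, 0 < w < pi & cpsi w < e.
Proof.
move=> e0; have e20 : 0 < e / 2 by rewrite divr_gt0.
have w0 : 0 < atan (e / 2) by rewrite -[X in X < _]atan0 lt_atan.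
have w1 := atan_ltpi2 (e / 2); have w2 := atan_gtNpi2 (e / 2).
have wp : atan (e / 2) < pi by rewrite (lt_trans w1)// ltr_pdivrMr// ltr_pMr ?pi_gt0// ltr1n.
have te : tan (atan (e / 2)) < e by rewrite atanK ltr_pdivrMr// ltr_pMr// ltr1n.
set w := atan (e / 2) in w0 w1 w2 wp te *.
exists w; first by rewrite w0.
have s0 : 0 < sin w by rewrite sin_gt0_pi// w0.
have c0 : 0 < cos w by rewrite cos_gt0_pihalf// w1 w2.
apply: lt_trans te; rewrite /cpsi /tan ltr_pdivrMr ?exprn_gt0//.
have -> : sin w / cos w * sin w ^+ 2 = (sin w - sin w * cos w ^+ 2) / cos w.
  by rewrite sin2cos2; field; rewrite gt_eqF.
by rewrite ltr_pdivlMr//; have := mul_cos_lt_sin w0 wp; nra.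
Qed.

Lemma cpsi_large e : exists2 w, 0 < w < pi & e < cpsi w.
Proof.
set t := (1 + `|e|)^-1.
have e1 : 0 < 1 + `|e| by rewrite ltr_pwDl.
have t0 : 0 < t by rewrite invr_gt0.
have t1 : t <= 1 by rewrite invf_le1// lerDl.
have h1 := pihalf_ge1 R; have p0 := pi_gt0 R.
have pe : pi = pi / 2 + pi / 2 :> R by field.
exists (pi - t); first by apply/andP; split; lra.
have st : sin (pi - t) = sin t by rewrite sinB sinpi cospi; ring.
have ct : cos (pi - t) = - cos t by rewrite cosB sinpi cospi; ring.
have s0 : 0 < sin t by rewrite sin_gt0_pi// t0/=; lra.
have c0 : 0 <= cos t by apply: cos_ge0_pihalf; apply/andP; split; lra.
have ts := sin_lt_id t0.
rewrite /cpsi st ct ltr_pdivlMr ?exprn_gt0//.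
have te : t * (1 + `|e|) = 1 by rewrite mulVf// gt_eqF.
have s2 : sin t ^+ 2 <= t by nra.
have e2 : e * sin t ^+ 2 <= `|e| * t.
  apply: (@le_trans _ _ (`|e| * sin t ^+ 2)); first by rewrite ler_wpM2r ?sqr_ge0 ?ler_norm.
  by rewrite ler_wpM2l.
have := mulr_ge0 (ltW s0) c0; lra.
Qed.

End cycloid_functions.

Section dini.
Context {R : realType}.
Implicit Types (W : R -> R) (a b : R).

Lemma within_itv_dist W a b m e : {within `[a, b], continuous W} ->
  a <= m <= b -> 0 < e ->
  exists2 d, 0 < d & forall y, a <= y <= b -> `|y - m| < d -> `|W m - W y| < e.
Proof.
move=> /subspace_continuousP cW mab e0.
have {cW} := cW m; rewrite /= in_itv/= => /(_ mab) /cvgrPdist_lt /(_ e e0).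
rewrite /prop_near1 /within/= => -[d d0 dP]; exists d => // y yab ym.
by apply: dP => //=; rewrite ?in_itv// distrC.
Qed.

(* Only right increments are controlled, so a supremum argument replaces the mean value theorem. *)
Lemma nonincreasing_right_increment W a b : a < b ->
  {within `[a, b], continuous W} ->
  (forall t, a < t < b ->
     exists2 d, 0 < d & forall h, 0 < h < d -> W (t + h) <= W t) ->
  W b <= W a.
Proof.
move=> ab cW dW.
have step s : a < s < b -> W b <= W s.
  move=> /andP[as_ sb].
  pose E := [set t | s <= t <= b /\ W t <= W s].
  have Es : E s by split; rewrite ?lexx ?(ltW sb).
  have Eb : ubound E b by move=> t [/andP[]].
  have hE : has_sup E by split; [exists s|exists b].
  have sm : s <= sup E by apply: (ub_le_sup _ Es); exists b.
  have mb : sup E <= b by apply: ge_sup => //; exists s.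
  set m := sup E in sm mb.
  have mab : a <= m <= b by rewrite mb andbT (le_trans (ltW as_)).
  have Wm : W m <= W s.
    rewrite leNgt; apply/negP => sWm.
    have [|d d0 dP] := within_itv_dist cW mab (e := W m - W s); first by rewrite subr_gt0.
    have [t [/andP[st tb] Wt] mt] := sup_adherent d0 hE.
    have tm : t <= m by apply: ub_le_sup; [exists b|split; rewrite ?st].
    have := dP t; rewrite tb (le_trans (ltW as_) st) => /(_ isT).
    rewrite ler0_norm ?subr_le0// opprB => H.
    have : m - t < d by rewrite ltrBlDr -ltrBlDl.
    by move=> /H; have := ler_norm (W m - W t); lra.
  have [bm|mltb] := leP b m; first by have -> : b = m by apply/eqP; rewrite eq_le bm.
  have [|d d0 dP] := dW m; first by rewrite mltb (lt_le_trans as_ sm).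
  have h0 : 0 < Num.min (d / 2) ((b - m) / 2) by rewrite lt_min !divr_gt0// subr_gt0.
  set h := Num.min _ _ in h0.
  have hd : h < d by rewrite (@le_lt_trans _ _ (d / 2)) ?ge_min ?lexx//; lra.
  have hb : h <= (b - m) / 2 by rewrite ge_min lexx orbT.
  have : m + h <= m.
    apply: ub_le_sup; first by exists b.
    split; first by apply/andP; split; lra.
    by apply: le_trans Wm; apply: dP; rewrite h0.
  lra.
rewrite leNgt; apply/negP => Wab.
have [||d d0 dP] := @within_itv_dist W a b a (W b - W a) cW.
- by rewrite lexx ltW.
- by rewrite subr_gt0.
have h0 : 0 < Num.min (d / 2) ((b - a) / 2) by rewrite lt_min !divr_gt0// subr_gt0.
set h := Num.min _ _ in h0.
have hd : h < d by rewrite (@le_lt_trans _ _ (d / 2)) ?ge_min ?lexx//; lra.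
have hb : h <= (b - a) / 2 by rewrite ge_min lexx orbT.
have := step (a + h); have := dP (a + h).
rewrite addrAC subrr add0r gtr0_norm//.
have -> : a <= a + h <= b by apply/andP; split; lra.
have -> : a < a + h < b by apply/andP; split; lra.
move=> /(_ isT hd) + /(_ isT).
by rewrite distrC; have := ler_norm (W (a + h) - W a); lra.
Qed.

End dini.

Section majorant.
Context {R : realType}.
Notation mu := (@lebesgue_measure R).
Variables (l : R -> R) (L e : R).
Hypothesis ml : measurable_fun (`]0, 1[%classic : set R) l.
Hypothesis l0 : forall t : R, 0 < t < 1 -> 0 <= l t.
Hypothesis lL : (\int[mu]_(t in `]0%R, 1%R[%classic) (l t)%:E = L%:E)%E.
Hypothesis e0 : 0 < e.

Let D : set R := `]0, 1[.
Let slice (k : nat) : set R := D `&` [set t | k%:R * e <= l t < k.+1%:R * e].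
Let wt (k : nat) : R := k.+2%:R * e.

Let wt0 k : 0 < wt k. Proof. by rewrite mulr_gt0. Qed.

Let mslice k : measurable (slice k).
Proof.
have -> : slice k = D `&` l @^-1` `[k%:R * e, k.+1%:R * e[.
  by apply/seteqP; split => t [Dt /=]; rewrite in_itv/=; split.
by apply: ml => //; exact: measurable_itv.
Qed.

Let bigcup_slice : \bigcup_k slice k = D.
Proof.
apply/seteqP; split => [t [k _ []]//|t Dt].
have := Dt; rewrite /D/= in_itv/= => /l0 lt0.
exists (Num.truncn (l t / e)) => //; split => //=.
have := @Num.Theory.truncn_itv R (l t / e); rewrite divr_ge0// ?(ltW e0)// => /(_ isT).
by rewrite ler_pdivlMr// ltr_pdivrMr.
Qed.

Let trivIset_slice : trivIset setT slice.
Proof.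
apply/trivIsetP => i j _ _ ij; apply/seteqP; split => // t [[_ /andP[a b]] [_ /andP[c d]]].
have := le_lt_trans a d; have := le_lt_trans c b.
rewrite !ltr_pM2r// !ltr_nat !ltnS => ji ij'.
by move: ij; rewrite eqn_leq ji ij'.
Qed.

Let mu_slice k : (mu (slice k) < +oo)%E.
Proof.
apply: (@le_lt_trans _ _ (mu `]0%R, 1%R[%classic)).
  by apply: le_measure; [rewrite inE; exact: mslice|rewrite inE; exact: measurable_itv|move=> t []].
by rewrite lebesgue_measure_itv/= lte_fin ltr01 -EFinB ltry.
Qed.

Lemma slice_weights : (\sum_(k <oo) (wt k)%:E * mu (slice k) <= (L + 2 * e)%:E)%E.
Proof.
have mD : measurable D by exact: measurable_itv.
have -> : ((L + 2 * e)%:E = \int[mu]_(t in D) ((l t)%:E + (2 * e)%:E))%E.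
  rewrite ge0_integralD//=.
  - by rewrite lL integral_cst//= lebesgue_measure_itv/= lte_fin ltr01 -EFinB subr0 mule1.
  - exact/measurable_EFinP.
  - by move=> t _; rewrite lee_fin mulr_ge0// ltW.
have mle : measurable_fun D (fun t => (l t)%:E + (2 * e)%:E)%E.
  by apply: emeasurable_funD => //; exact/measurable_EFinP.
have le0 t : D t -> (0 <= (l t)%:E + (2 * e)%:E)%E.
  rewrite /D/= in_itv/= => /l0 lt0; rewrite -EFinD lee_fin addr_ge0//.
  by rewrite mulr_ge0// ltW.
rewrite -bigcup_slice ge0_integral_bigcup ?bigcup_slice//.
apply: lee_nneseries => [k _ _|k _]; first by rewrite mule_ge0// lee_fin ltW.
rewrite -integral_cst; last exact: mslice.
apply: ge0_le_integral => //=.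
- exact: mslice.
- by move=> t _; rewrite lee_fin ltW.
- by apply: measurable_funS mle => // t [].
- move=> t [_ /andP[kt _]]; rewrite -EFinD lee_fin /wt.
  by rewrite -addn2 natrD mulrDl lerD2r.
Qed.

Lemma open_slice_cover : exists V : (set R)^nat, forall k,
  [/\ open (V k), slice k `<=` V k &
      (mu (V k) <= mu (slice k) + (e / (2 ^ k.+1)%:R / wt k)%:E)%E].
Proof.
have W k : exists V, [/\ open V, slice k `<=` V &
    (mu V <= mu (slice k) + (e / (2 ^ k.+1)%:R / wt k)%:E)%E].
  have h0 : 0 < e / (2 ^ k.+1)%:R / wt k.
    by rewrite !divr_gt0// ltr0n expn_gt0.
  have [U [oU sU Ue]] := lebesgue_regularity_outer (mslice k) (mu_slice k) h0.
  exists U; split => //.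
  have mU : measurable U by exact: open_measurable.
  rewrite -[X in mu X](setDUK sU).
  have mUD : measurable (U `\` slice k) by apply: measurableD => //; exact: mslice.
  apply: le_trans; first by apply: measureU2 => //; exact: mslice.
  by apply: leeD2l; exact: ltW.
by have [V HV] := choice W; exists V.
Qed.

(* Vitali-Caratheodory: [h] sums the weights [wt k] over open sets slightly larger than the
   slices, so that it stays above [l t + e] on a neighbourhood of each [t]. *)
Lemma lsc_majorant : exists h : R -> R,
  [/\ mu.-integrable `[0%R, 1%R]%classic (EFin \o h),
     (\int[mu]_(t in `[0%R, 1%R]%classic) (h t)%:E <= (L + 3 * e)%:E)%E,
     forall t, 0 <= h t &
     forall t, 0 < t < 1 -> exists2 d, 0 < d & forall b, t < b < t + d ->
       b <= 1 /\
       (((l t + e) * (b - t))%:E <= \int[mu]_(s in `]t, b]%classic) (h s)%:E)%E].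
Proof.
have [U HU] := open_slice_cover.
pose I : set R := `[0, 1]%classic.
have mI : measurable I by exact: measurable_itv.
have DI : D `<=` I by move=> t; rewrite /D/I/= !in_itv/= => /andP[/ltW-> /ltW->].
have oD : open D by exact: itv_open.
pose V k := U k `&` D.
have oV k : open (V k) by apply: openI => //; case: (HU k).
have mV k : measurable (V k) by exact: open_measurable.
have VI k : V k `<=` I by move=> t [_ /DI].
have sV k : slice k `<=` V k.
  by move=> t st; split; [case: (HU k) => _ /(_ _ st)|case: st].
pose g k (t : R) : \bar R := ((wt k)%:E * (\1_(V k) t)%:E)%E.
have g0 k t : (0 <= g k t)%E by rewrite mule_ge0// lee_fin// ltW.
have mi k A : measurable_fun A (fun t : R => (\1_(V k) t : R)%:E).
  by apply/measurable_EFinP; exact: measurable_indic.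
have mg k A : measurable_fun A (g k) by exact: measurable_funeM.
pose hE t := (\sum_(k <oo) g k t)%E.
have hE0 t : (0 <= hE t)%E by apply: nneseries_ge0 => k _ _; exact: g0.
have mhE A : measurable_fun A hE.
  by apply: (@ge0_emeasurable_sum _ _ _ A g predT).
have ihE : (\int[mu]_(t in I) hE t <= (L + 3 * e)%:E)%E.
  rewrite integral_nneseries//; last by move=> k; exact: mg.
  apply: (@le_trans _ _ (\sum_(k <oo) ((wt k)%:E * mu (slice k) + (e / (2 ^ k.+1)%:R)%:E))%E).
    apply: lee_nneseries => [k _ _|k _]; first by apply: integral_ge0 => t _; exact: g0.
    rewrite ge0_integralZl//; last 2 first.
    - exact: mi.
    - by rewrite lee_fin ltW.
    rewrite integral_indic; [|exact: mI|exact: mV].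
    rewrite (setIidl (VI k : V k `<=` I)).
    apply: (@le_trans _ _ ((wt k)%:E * (mu (slice k) + (e / (2 ^ k.+1)%:R / wt k)%:E))%E).
      apply: lee_wpmul2l; first by rewrite lee_fin ltW.
      have [oU _] := HU k; apply: le_trans.
      apply: le_measure; [rewrite inE; exact: mV|rewrite inE; exact: open_measurable|].
      by move=> t [].
    rewrite ge0_muleDr//; last by rewrite lee_fin !divr_ge0// ltW.
    by rewrite -EFinM mulrC divfK// gt_eqF.
  apply: (le_trans (epsilon_trick _ _ _)).
  - by move=> n; rewrite mule_ge0// lee_fin ltW.
  - exact: ltW.
  apply: (le_trans (leeD2r _ slice_weights)).
  by rewrite -EFinD lee_fin; lra.
have inthE : mu.-integrable I hE.
  apply/integrableP; split; first exact: mhE.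
  under eq_integral do rewrite gee0_abs//.
  by apply: (le_lt_trans ihE); rewrite ltry.
pose h t := fine (hE t).
have hle t : ((h t)%:E <= hE t)%E.
  by rewrite /h; have := hE0 t; case: (hE t) => [r|_|]//=; rewrite leey.
have h0 t : 0 <= h t by apply: fine_ge0.
have mh A : measurable_fun A (EFin \o h).
  by apply/measurable_EFinP; apply: measurableT_comp.
have inth : mu.-integrable I (EFin \o h).
  apply: (le_integrable _ _ _ inthE); [exact: mI|exact: mh|move=> t _].
  rewrite gee0_abs; last by rewrite lee_fin.
  by rewrite gee0_abs; [exact: hle|exact: hE0].
exists h; split => //.
- by apply: le_trans ihE; apply: ge0_le_integral;
    first [exact: mI|exact: mh|exact: mhE|by move=> t _; rewrite lee_fin|by move=> t _; exact: hle].
move=> t t01.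
have Dt : D t by rewrite /D/= in_itv.
have [k _ kt] : (\bigcup_k slice k) t by rewrite bigcup_slice.
have /nbhs_ballP[d d0 dV] : nbhs t (V k) by apply: (open_nbhs_nbhs (conj (oV k) (sV k t kt))).
exists d => // b /andP[tb bd].
have sub : `]t, b]%classic `<=` V k.
  move=> s; rewrite /= in_itv/= => /andP[ts sb]; apply: dV; rewrite /ball/=.
  by rewrite ltr0_norm ?subr_lt0//; move: sb bd => /=; lra.
have b1 : b < 1.
  have /sub[_] : `]t, b]%classic b by rewrite /= in_itv/= lexx tb.
  by rewrite /D/= in_itv/= => /andP[].
split; first exact: ltW.
have mJ : measurable (`]t, b]%classic : set R) by exact: measurable_itv.
have JI : `]t, b]%classic `<=` I by move=> s /sub /VI.
have -> : (\int[mu]_(s in `]t, b]%classic) (h s)%:E = \int[mu]_(s in `]t, b]%classic) hE s)%E.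
  apply: ae_eq_integral => //; [exact: mh|exact: mhE|].
  have inthJ : mu.-integrable `]t, b]%classic hE.
    by apply: integrableS inthE; [exact: mI|exact: mJ|exact: JI].
  have : {ae mu, forall s, `]t, b]%classic s -> hE s \is a fin_num}.
    by apply: integrable_ae inthJ; exact: mJ.
  case=> N [mN N0 NS]; exists N; split => //; apply: subset_trans NS.
  by apply: subsetC => s hs Js; rewrite /= /h fineK//; exact: hs.
apply: (@le_trans _ _ (\int[mu]_(s in `]t, b]%classic) cst (wt k)%:E s)%E).
  rewrite integral_cst//= lebesgue_measure_itv/= lte_fin tb -EFinB -EFinM lee_fin.
  rewrite ler_wpM2r ?subr_ge0 ?(ltW tb)//.
  case: kt => _ /= /andP[_ hk].
  by rewrite /wt -[k.+2]addn1 natrD mulrDl mul1r lerD2r ltW.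
apply: ge0_le_integral => //=; [by move=> s _; rewrite lee_fin ltW|exact: mhE|].
move=> s Js; apply: le_trans (nneseries_lim_ge k.+1 _) => //.
rewrite big_nat_recr//= -[leLHS]add0e leeD//; first by apply: sume_ge0.
by rewrite /g indicE mem_set ?mule1//; exact: sub.
Qed.

End majorant.

Section difference_quotients.
Context {R : realType}.
Notation mu := (@lebesgue_measure R).
Implicit Types (f x : R -> R) (t e a : R).

Lemma der_dist f t a e : is_derive t 1 f a -> 0 < e ->
  exists2 d, 0 < d & forall h, h != 0 -> `|h| < d ->
    `|(f (t + h) - f t) / h - a| < e.
Proof.
move=> [df <-] e0; move: df => /cvg_ex[l hl].
have -> : 'D_1 f t = l by exact/cvg_lim.
move: hl => /cvgrPdist_lt/(_ e e0).
rewrite /prop_near1 /nbhs/= => -[d d0 dP]; exists d => // h h0 hd.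
have := dP h; rewrite /ball_/= sub0r normrN => /(_ hd h0).
by rewrite distrC /GRing.scale/= mulr1 [h + t]addrC mulrC.
Qed.

Lemma measurable_derive1 x : {within `[0, 1], continuous x} ->
  (forall t, 0 < t < 1 -> derivable x t 1) ->
  measurable_fun (`]0, 1[%classic : set R) (derive1 x).
Proof.
move=> cx dx.
have mx : measurable_fun setT (x \_ `[0, 1]).
  apply/(measurable_restrictT x) => //.
  exact: subspace_continuous_measurable_fun.
pose u (n : nat) (t : R) : R :=
  ((x \_ `[0, 1]) (t + n.+1%:R^-1) - (x \_ `[0, 1]) t) * n.+1%:R.
apply: (@measurable_fun_cvg _ _ _ _ u).
  move=> n; apply: measurable_funM => //; apply: measurable_funB.
    apply: (measurable_comp (F := setT)) => //.
    exact: measurable_funD.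
  exact: measurable_funS mx.
move=> t; rewrite /= in_itv/= => t01.
have tt : t \in `[0, 1]%classic.
  by rewrite inE/= in_itv/=; case/andP: t01 => /ltW -> /ltW ->.
apply/cvgrPdist_lt => e e0.
have : is_derive t 1 x (derive1 x t) by rewrite derive1E; apply/derivableP/dx.
move=> /der_dist/(_ e0)[d d0 dP].
have m0 : 0 < Num.min d (1 - t).
  by rewrite lt_min d0 subr_gt0; case/andP: t01.
near=> n.
have : n.+1%:R^-1 < Num.min d (1 - t) by near: n; exact: near_infty_natSinv_lt (PosNum m0).
rewrite lt_min => /andP[nd n1].
have n0 : 0 < n.+1%:R^-1 :> R by rewrite invr_gt0.
rewrite distrC /u -[X in _ * X]invrK; set r := n.+1%:R^-1 in nd n1 n0 *.
rewrite !patchE tt mem_set; last first.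
  by rewrite /= in_itv/=; case/andP: t01 => t0 t1; apply/andP; split; lra.
by have := dP r; rewrite gt_eqF// gtr0_norm//; exact.
Unshelve. all: by end_near. Qed.

Lemma time_majorant (l : R -> R) (L e : R) :
  measurable_fun (`]0, 1[%classic : set R) l ->
  (forall t, 0 < t < 1 -> 0 <= l t) ->
  (\int[mu]_(t in `]0%R, 1%R[%classic) (l t)%:E = L%:E)%E -> 0 < e ->
  exists H : R -> R,
  [/\ {within `[0, 1], continuous H}, H 0 = 0, H 1 <= L + 3 * e,
      forall s t, 0 <= s -> s <= t -> t <= 1 -> H s <= H t &
      forall t, 0 < t < 1 -> exists2 d, 0 < d & forall b, t < b < t + d ->
        b <= 1 /\ (l t + e) * (b - t) <= H b - H t].
Proof.
move=> ml l0 lL e0; have [h [ih hL h0 hinc]] := lsc_majorant ml l0 lL e0.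
pose H t := parameterized_integral mu 0 t h.
have HB s t : 0 <= s -> s <= t -> t <= 1 ->
    H t - H s = \int[mu]_(u in `]s, t]%classic) h u.
  move=> s0 st t1; rewrite /H /parameterized_integral Rintegral_itvB//.
  by apply: integrableS ih => //; apply: subset_itvl; rewrite bnd_simp.
exists H; split.
- exact: parameterized_integral_continuous.
- by rewrite /H /parameterized_integral set_itv1 Rintegral_set1.
- rewrite -lee_fin; apply: le_trans hL.
  rewrite /H /parameterized_integral /Rintegral fineK//.
  exact: integrable_fin_num.
- move=> s t s0 st t1; rewrite -subr_ge0 HB//; apply: Rintegral_ge0 => u _; exact: h0.
- move=> t t01; have [d d0 dP] := hinc t t01; exists d => // b tb.
  have [b1 hb] := dP b tb; split => //.
  case/andP: t01 => t0 _; case/andP: tb => tb _.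
  rewrite HB ?(ltW t0) ?(ltW tb)// /Rintegral -lee_fin fineK//.
  apply: integrable_fin_num => //; apply: integrableS ih => //.
  by apply: subset_itv; rewrite bnd_simp// ltW.
Qed.

End difference_quotients.

Section calibration.
Context {R : realType}.
Notation mu := (@lebesgue_measure R).

Lemma cvg_der_quotient (T : Type) (F : set_system T) (FF : Filter F)
    (f : R -> R) (g : T -> R) (s d : R) : is_derive s 1 f d ->
  g @ F --> s -> (\forall b \near F, g b != s) ->
  (f (g b) - f s) / (g b - s) @[b --> F] --> d.
Proof.
move=> fd gs gn; apply/cvgrPdist_lt => e e0.
have [r r0 rP] := der_dist fd e0.
have /cvgrPdist_lt/(_ _ r0) gr := gs.
near=> b.
have gb : g b != s by near: b.
have gbr : `|s - g b| < r by near: b.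
by have := rP (g b - s); rewrite subr_eq0 gb distrC gbr addrCA subrr addr0 distrC; exact.
Unshelve. all: by end_near. Qed.

(* Young's inequality [T z <= T^2 + z^2 / 4], strict because [z^2 < G] when [z != 0]. *)
Lemma young_strict (T l e y G : R) : 0 < T -> 0 <= l -> 0 < e -> 0 <= y ->
  0 <= G -> y ^+ 2 <= G * l ^+ 2 -> T / (l + e) * y - G / 4 < T ^+ 2.
Proof.
move=> T0 l0 e0 y0 G0 yG; have le0 : 0 < l + e by rewrite ltr_wpDl.
pose z := y / (l + e).
have yz : y = z * (l + e) by rewrite /z divfK// gt_eqF.
have -> : T / (l + e) * y = T * z by rewrite yz; field; rewrite gt_eqF.
have [z0|z0] := leP z 0; first by nra.
suff zG : z ^+ 2 < G by have := sqr_ge0 (T - z / 2); lra.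
have le2 : l ^+ 2 < (l + e) ^+ 2 by rewrite ltr_sqr ?nnegrE ?(ltW le0)// ltrDl.
rewrite -(ltr_pM2r (exprn_gt0 2 le0)) -exprMn -yz (le_lt_trans yG)// ltr_pM2l//.
rewrite lt_neqAle G0 andbT eq_sym; apply: contraTN yG => /eqP ->.
by rewrite mul0r -ltNge yz exprn_gt0// mulr_gt0.
Qed.

Lemma cauchy_speed (m x' v' al v r : R) : 0 < v -> r ^+ 2 = v ->
  (m * x' + v' * al / (2 * r)) ^+ 2 <=
  (m ^+ 2 * r ^+ 2 + al ^+ 2 / 4) * ((x' ^+ 2 + v' ^+ 2) / v).
Proof.
move=> v0 rv; have r0 : r != 0 by apply: contraTneq v0 => r0; rewrite -rv r0 expr0n ltxx.
rewrite -subr_ge0 -rv.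
have -> : (m ^+ 2 * r ^+ 2 + al ^+ 2 / 4) * ((x' ^+ 2 + v' ^+ 2) / r ^+ 2) -
  (m * x' + v' * al / (2 * r)) ^+ 2 = (m * v' - x' * al / (2 * r)) ^+ 2.
  by field.
exact: sqr_ge0.
Qed.

(* [u] is a subsolution of the Hamilton-Jacobi equation of the energy
   [4 r'^2 + x'^2 / r^2], where [r] is the square root of [v]. *)
Variables (m : R) (a b c a' b' c' : R -> R).
Hypothesis der_a : forall t : R, 0 <= t <= 1 -> is_derive t 1 a (a' t).
Hypothesis der_b : forall t : R, 0 <= t <= 1 -> is_derive t 1 b (b' t).
Hypothesis der_c : forall t : R, 0 <= t <= 1 -> is_derive t 1 c (c' t).
Hypothesis subsolution : forall t r : R, 0 <= t <= 1 ->
  a' t * r ^+ 2 + b' t * r + c' t <=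
  - (m ^+ 2 * r ^+ 2 + (2 * a t * r + b t) ^+ 2 / 4) / 4.

Let u (t x v : R) := m * x + a t * v + b t * Num.sqrt v + c t.

Variables (x v : R -> R).
Hypothesis cx : {within `[0, 1], continuous x}.
Hypothesis cv : {within `[0, 1], continuous v}.
Hypothesis dxv : forall t : R, 0 < t < 1 -> [/\ derivable x t 1, derivable v t 1 & 0 < v t].

Let speed (t : R) := Num.sqrt ((derive1 x t ^+ 2 + derive1 v t ^+ 2) / v t).

Lemma calibration_step (H : R -> R) (t e d0 : R) : 0 < t < 1 -> 0 < e -> 0 < H 1 -> 0 < d0 ->
  0 <= H t <= H 1 -> H h @[h --> t^'+] --> H t ->
  (forall s, t < s < t + d0 -> s <= 1 /\ (speed t + e) * (s - t) <= H s - H t) ->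
  \forall s \near t^'+,
    u (H s / H 1) (x s) (v s) - H 1 * H s <= u (H t / H 1) (x t) (v t) - H 1 * H t.
Proof.
move=> t01 e0 T0 d00 Ht cH Hinc; set T := H 1 in T0 Ht *.
have [dx dv vt0] := dxv t01.
have r0 : 0 < Num.sqrt (v t) by rewrite sqrtr_gt0.
have rv : Num.sqrt (v t) ^+ 2 = v t by rewrite sqr_sqrtr// ltW.
set r := Num.sqrt (v t) in r0 rv.
have xd : is_derive t 1 x (derive1 x t) by rewrite derive1E; exact: derivableP.
have vd : is_derive t 1 v (derive1 v t) by rewrite derive1E; exact: derivableP.
have rd : is_derive t 1 (fun s => Num.sqrt (v s)) ((2 * r)^-1 * derive1 v t).
  exact: der_sqrt.
set x' := derive1 x t in xd; set v' := derive1 v t in vd rd.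
set l := speed t in Hinc.
have l0 : 0 <= l by exact: sqrtr_ge0.
have l2 : l ^+ 2 = (x' ^+ 2 + v' ^+ 2) / v t.
  by rewrite sqr_sqrtr// divr_ge0// ?addr_ge0 ?sqr_ge0// ltW.
pose sg s := H s / T.
have sgt : 0 <= sg t <= 1 by case/andP: Ht => H0 HT; rewrite divr_ge0 ?(ltW T0)//= ler_pdivrMr// mul1r.
have csg : sg s @[s --> t^'+] --> sg t by apply: cvgM => //; exact: cvg_cst.
have nt : \forall s \near t^'+, t < s < t + d0.
  near=> s; apply/andP; split; first by near: s; exact: nbhs_right_gt.
  by near: s; apply: nbhs_right_lt; rewrite ltrDl.
have sgn : \forall s \near t^'+, sg s != sg t.
  apply: filterS nt => s ts; have [_] := Hinc s ts; case/andP: ts => ts _ hs.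
  rewrite gt_eqF// ltr_pM2r ?invr_gt0// -subr_gt0 (lt_le_trans _ hs)// mulr_gt0 ?subr_gt0//.
  by rewrite ltr_wpDl.
have idn : \forall s \near t^'+, (s : R) != t.
  by apply: filterS nt => s /andP[ts _]; rewrite gt_eqF.
have idc : (s : R) @[s --> t^'+] --> t by apply: cvg_within.
have FF : Filter (t^'+) by exact: at_right_proper_filter.
have qx := cvg_der_quotient FF xd idc idn.
have qv := cvg_der_quotient FF vd idc idn.
have qr := cvg_der_quotient FF rd idc idn.
have qa := cvg_der_quotient FF (der_a sgt) csg sgn.
have qb := cvg_der_quotient FF (der_b sgt) csg sgn.
have qc := cvg_der_quotient FF (der_c sgt) csg sgn.
have cv' : v s @[s --> t^'+] --> v t.
  by apply: cvg_at_right_filter; exact: der_continuous vd.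
have cr' : Num.sqrt (v s) @[s --> t^'+] --> r.
  by apply: (@cvg_at_right_filter _ _ (fun s => Num.sqrt (v s))); exact: der_continuous rd.
pose B1 s := m * ((x s - x t) / (s - t)) + a (sg t) * ((v s - v t) / (s - t))
  + b (sg t) * ((Num.sqrt (v s) - r) / (s - t)).
pose B2 s := v s * ((a (sg s) - a (sg t)) / (sg s - sg t))
  + Num.sqrt (v s) * ((b (sg s) - b (sg t)) / (sg s - sg t))
  + (c (sg s) - c (sg t)) / (sg s - sg t).
pose M := m * x' + a (sg t) * v' + b (sg t) * ((2 * r)^-1 * v').
pose N := v t * a' (sg t) + r * b' (sg t) + c' (sg t).
have cB1 : B1 s @[s --> t^'+] --> M.
  exact: (cvgD (cvgD (cvgM (cvg_cst m) qx) (cvgM (cvg_cst _) qv)) (cvgM (cvg_cst _) qr)).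
have cB2 : B2 s @[s --> t^'+] --> N.
  exact: (cvgD (cvgD (cvgM cv' qa) (cvgM cr' qb)) qc).
have cB : T / (l + e) * `|B1 s| + B2 s @[s --> t^'+] --> T / (l + e) * `|M| + N.
  exact: (cvgD (cvgM (cvg_cst _) (cvg_norm cB1)) cB2).
have MN : T / (l + e) * `|M| + N < T ^+ 2.
  pose G := m ^+ 2 * r ^+ 2 + (2 * a (sg t) * r + b (sg t)) ^+ 2 / 4.
  have NG : N <= - G / 4.
    by have := subsolution r sgt; rewrite /N /G -rv; lra.
  have MG : M ^+ 2 <= G * l ^+ 2.
    rewrite l2 /G; apply: le_trans (cauchy_speed _ _ _ _ vt0 rv).
    rewrite le_eqVlt; apply/orP; left; apply/eqP; congr (_ ^+ 2).
    by rewrite /M; field; rewrite gt_eqF.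
  have G0 : 0 <= G.
    by apply: addr_ge0; [apply: mulr_ge0|apply: divr_ge0 => //]; exact: sqr_ge0.
  have := @young_strict T l e `|M| G T0 l0 e0 (normr_ge0 _) G0.
  rewrite real_normK ?num_real// => /(_ MG); lra.
have nB : \forall s \near t^'+, T / (l + e) * `|B1 s| + B2 s < T ^+ 2.
  exact: (cvgr_lt _ cB).
near=> s.
have ts : t < s < t + d0 by near: s.
have Bs : T / (l + e) * `|B1 s| + B2 s < T ^+ 2 by near: s.
have [_ hs] := Hinc s ts.
have st0 : 0 < s - t by case/andP: ts; rewrite subr_gt0.
have le0 : 0 < l + e by rewrite ltr_wpDl.
have HT : H s - H t = T * (sg s - sg t).
  by rewrite /sg; field; rewrite gt_eqF.
have D0 : 0 < sg s - sg t.
  by rewrite -(pmulr_rgt0 _ T0) -HT (lt_le_trans _ hs)// mulr_gt0.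
have ident : u (H s / T) (x s) (v s) - T * H s - (u (H t / T) (x t) (v t) - T * H t)
  = (s - t) * B1 s + (sg s - sg t) * (B2 s - T ^+ 2).
  rewrite /u -!/(sg _) -/r.
  have -> : H s = H t + T * (sg s - sg t) by rewrite -HT addrC subrK.
  by rewrite /B1 /B2; field; rewrite !gt_eqF.
rewrite -subr_le0 ident.
have B1s : (s - t) * B1 s <= (sg s - sg t) * (T / (l + e) * `|B1 s|).
  apply: (@le_trans _ _ ((s - t) * `|B1 s|)); first by rewrite ler_pM2l// ler_norm.
  rewrite mulrA ler_wpM2r// mulrA ler_pdivlMr// mulrC [X in _ <= X]mulrC -HT.
  exact: hs.
apply: (@le_trans _ _ ((sg s - sg t) * (T / (l + e) * `|B1 s| + B2 s - T ^+ 2))); first by lra.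
by rewrite pmulr_rle0// subr_le0 ltW.
Unshelve. all: by end_near. Qed.

Let interval_near_right (P : set R) (t : R) : (\forall s \near t^'+, P s) ->
  exists2 d, 0 < d & forall h, 0 < h < d -> P (t + h).
Proof.
move=> [d d0 dP]; exists d => // h /andP[h0 hd]; apply: dP; last by rewrite /= ltrDl.
by rewrite /ball_/= opprD addrA subrr sub0r normrN gtr0_norm.
Qed.

Lemma measurable_speed : measurable_fun (`]0, 1[%classic : set R) speed.
Proof.
have dx t : 0 < t < 1 -> derivable x t 1 by move=> /dxv[].
have dv t : 0 < t < 1 -> derivable v t 1 by move=> /dxv[].
apply: (measurable_comp (F := setT)) => //.
  by apply: continuous_measurable_fun; exact: sqrt_continuous.
apply: measurable_funM.
  by apply: measurable_funD; apply: measurable_funX; exact: measurable_derive1.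
apply: subspace_continuous_measurable_fun => //.
rewrite continuous_open_subspace; last exact: itv_open.
move=> t; rewrite inE/= in_itv/= => t01; apply: cvgV.
  by rewrite gt_eqF//; case: (dxv t01).
have /derivableP := dv t t01; exact: der_continuous.
Qed.

Lemma calibration_le_length (L : R) : path_length x v = L%:E ->
  u 1 (x 1) (v 1) - u 0 (x 0) (v 0) <= L ^+ 2.
Proof.
move=> HL.
have ms := measurable_speed.
have mE : measurable_fun (`]0, 1[%classic : set R) (EFin \o speed).
  exact/measurable_EFinP.
have sL : (\int[mu]_(t in `]0%R, 1%R[%classic) (speed t)%:E = L%:E)%E.
  rewrite -HL /path_length integral_itv_bndo_bndc// integral_itv_obnd_cbnd//.
  by apply/emeasurable_fun_itv_bndo_bndcP.
have s0 t : 0 <= speed t by exact: sqrtr_ge0.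
have L0 : 0 <= L by rewrite -lee_fin -sL; apply: integral_ge0 => t _; rewrite lee_fin.
have key e : 0 < e -> u 1 (x 1) (v 1) - u 0 (x 0) (v 0) <= (L + 3 * e) ^+ 2.
  move=> e0.
  have [H [cH H0 H1 mH incH]] := time_majorant ms (fun t _ => s0 t) sL e0.
  set T := H 1 in H1.
  have T0 : 0 < T.
    have h12 : 0 < (2^-1 : R) < 1 by apply/andP; split; lra.
    have [d d0 /(_ (2^-1 + d / 2))[]] := incH _ h12; first by apply/andP; split; lra.
    set b1 := 2^-1 + d / 2 => b11 hb.
    have : 0 < (speed 2^-1 + e) * (b1 - 2^-1).
      by apply: mulr_gt0; [rewrite ltr_wpDl|rewrite /b1; lra].
    have : H 0 <= H 2^-1 by apply: mH; lra.
    have : H b1 <= T by apply: mH => //; rewrite /b1; lra.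
    by rewrite H0; lra.
  have HT t : 0 <= t <= 1 -> 0 <= H t <= T.
    by move=> /andP[t0 t1]; rewrite -H0 !mH.
  have sgP t : 0 <= t <= 1 -> 0 <= H t / T <= 1.
    by move=> /HT/andP[h0 h1]; rewrite divr_ge0 ?(ltW T0)//= ler_pdivrMr// mul1r.
  pose W t := u (H t / T) (x t) (v t) - T * H t.
  have cW : {within `[0, 1], continuous W}.
    apply/subspace_continuousP => t t01; have t01' := t01; rewrite /= in_itv/= in t01'.
    pose F : set_system R := within `[0, 1]%classic (nbhs t).
    have FF : Filter F by exact: within_filter.
    have cHt : H s @[s --> F] --> H t := (subspace_continuousP _ _).1 cH t t01.
    have cxt : x s @[s --> F] --> x t := (subspace_continuousP _ _).1 cx t t01.
    have cvt : v s @[s --> F] --> v t := (subspace_continuousP _ _).1 cv t t01.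
    have cst : H s / T @[s --> F] --> H t / T by exact: (cvgM cHt (cvg_cst T^-1)).
    have ca := cvg_comp _ _ cst (der_continuous (der_a (sgP t t01'))).
    have cb := cvg_comp _ _ cst (der_continuous (der_b (sgP t t01'))).
    have cc := cvg_comp _ _ cst (der_continuous (der_c (sgP t t01'))).
    have cr := cvg_comp _ _ cvt (@sqrt_continuous R (v t)).
    exact: (cvgB (cvgD (cvgD (cvgD (cvgM (cvg_cst m) cxt) (cvgM ca cvt)) (cvgM cb cr)) cc)
      (cvgM (cvg_cst T) cHt)).
  have dW t : 0 < t < 1 -> exists2 d, 0 < d & forall h, 0 < h < d -> W (t + h) <= W t.
    move=> t01; have [d d0 dP] := incH t t01.
    apply: (@interval_near_right (fun s => W s <= W t)); apply: (@calibration_step H t e d) => //.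
      by apply: HT; case/andP: t01 => /ltW-> /ltW->.
    apply: cvg_at_right_filter.
    by have [/(_ t) + _ _] := (continuous_within_itvP H ltr01).1 cH; apply; rewrite in_itv.
  have := nonincreasing_right_increment ltr01 cW dW.
  rewrite /W H0 mul0r mulr0 subr0 divff ?gt_eqF// => W10.
  apply: (@le_trans _ _ (T ^+ 2)); first by rewrite expr2 lerBlDr -lerBlDl.
  by rewrite ler_sqr ?nnegrE ?(ltW T0)//; apply: le_trans H1; exact: ltW.
rewrite leNgt; apply/negP => UL.
set U := _ - _ in key UL.
pose e := (U - L ^+ 2) / (U - L ^+ 2 + 6 * L + 10).
have de0 : 0 < U - L ^+ 2 by rewrite subr_gt0.
have den0 : 0 < U - L ^+ 2 + 6 * L + 10 by lra.
have e0 : 0 < e by rewrite divr_gt0.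
have ed : e * (U - L ^+ 2 + 6 * L + 10) = U - L ^+ 2 by rewrite divfK// gt_eqF.
have e1 : e < 1 by rewrite ltr_pdivrMr// mul1r; lra.
have := key e e0.
have := mulr_ge0 (ltW e0) L0; have := mulr_gt0 e0 de0; nra.
Qed.

End calibration.

Section heston_distance.
Context {R : realType}.
Notation mu := (@lebesgue_measure R).
Implicit Types (x v : R -> R) (w s t K : R).

Lemma path_length_ge0 x v : (0 <= path_length x v)%E.
Proof. by apply: integral_ge0 => t _; rewrite lee_fin sqrtr_ge0. Qed.

Lemma adm_path_length_cst p q x v K : adm_path p q x v ->
  (forall t, 0 < t < 1 -> (derive1 x t ^+ 2 + derive1 v t ^+ 2) / v t = K) ->
  path_length x v = (Num.sqrt K)%:E.
Proof.
move=> [_ _ cx cv dxv] HK.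
have mE : measurable_fun (`]0, 1[%classic : set R)
    (EFin \o (fun t => Num.sqrt ((derive1 x t ^+ 2 + derive1 v t ^+ 2) / v t))).
  by apply/measurable_EFinP; exact: measurable_speed.
rewrite /path_length -integral_itv_obnd_cbnd; last exact/emeasurable_fun_itv_bndo_bndcP.
rewrite -integral_itv_bndo_bndc//.
under eq_integral.
  by move=> t; rewrite inE/= in_itv/= => t01; rewrite HK//; over.
by rewrite integral_cst//= lebesgue_measure_itv/= lte_fin ltr01 -EFinB subr0 mule1.
Qed.

Lemma dH_eq p q K :
  (forall x v L, adm_path p q x v -> path_length x v = L%:E -> K <= L ^+ 2) ->
  (exists x v, adm_path p q x v /\
    forall t, 0 < t < 1 -> (derive1 x t ^+ 2 + derive1 v t ^+ 2) / v t = K) ->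
  dH p q = (Num.sqrt K)%:E.
Proof.
move=> lo [x [v [xv HK]]]; apply/eqP; rewrite eq_le; apply/andP; split.
  by apply: ereal_inf_lbound; exists x, v; rewrite (adm_path_length_cst xv HK).
apply: le_ereal_inf_tmp => _ [x1 [v1 [xv1 ->]]].
have := path_length_ge0 x1 v1; case E : (path_length x1 v1) => [L| |]; [|by move=> _; rewrite leey|by []].
rewrite !lee_fin => L0; rewrite -(ler_sqr (sqrtr_ge0 _) L0).
have KL := lo _ _ _ xv1 E.
have [K0|K0] := leP 0 K; first by rewrite sqr_sqrtr.
by rewrite ler0_sqrtr ?(ltW K0)// expr0n sqr_ge0.
Qed.

Lemma dH_origin : dH (0, 1) (0, 0) = 2%:E :> \bar R.
Proof.
have -> : (2 : R)%:E = (Num.sqrt 4)%:E.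
  by congr EFin; rewrite (_ : 4 = 2 ^+ 2) ?sqrtr_sqr ?ger0_norm//; ring.
apply: dH_eq => [x v L [[x0 v0] [x1 v1] cx cv dxv] HL|].
  have da (t : R) : is_derive t 1 (fun _ : R => 0 : R) 0 by exact: derC.
  have db (t : R) : is_derive t 1 (fun _ : R => - 8 : R) 0 by exact: derC.
  have dc (t : R) : is_derive t 1 (fun t : R => - 4 * t) (- 4) by der; ring.
  have sub (t r : R) : 0 <= t <= 1 ->
    0 * r ^+ 2 + 0 * r + - 4 <= - (0 ^+ 2 * r ^+ 2 + (2 * 0 * r + - 8) ^+ 2 / 4) / 4.
    by move=> _; lra.
  have := calibration_le_length (fun t _ => da t) (fun t _ => db t) (fun t _ => dc t) sub cx cv dxv HL.
  by rewrite v0 v1 x0 x1 sqrtr0 sqrtr1; lra.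
have dv (t : R) : is_derive t 1 (fun t : R => (1 - t) ^+ 2) (- 2 * (1 - t)) by der; ring.
exists (fun=> 0), (fun t => (1 - t) ^+ 2); split.
  split.
  - by rewrite subr0 expr1n.
  - by rewrite subrr expr0n.
  - by apply: continuous_subspaceT => t; exact: cst_continuous.
  - by apply: continuous_subspaceT => t; exact: der_continuous (dv t).
  - move=> t /andP[t0 t1]; split; [exact: derivable_cst|by case: (dv t)|].
    by rewrite exprn_gt0// subr_gt0.
move=> t /andP[t0 t1]; rewrite !derive1E derive_cst (@derive_val _ _ _ _ _ _ _ (dv t)).
by field; rewrite gt_eqF// subr_gt0.
Qed.

(* End point abscissa and squared length of the cycloid from [(0, 1)] to height [s^2] with
   angle [theta = 2 w]. *)
Definition cycloid_abs s w := cpsi w * (1 + s ^+ 2) + 2 * s * cphi w.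
Definition cycloid_sqdist s w :=
  4 * w ^+ 2 * (1 + s ^+ 2 - 2 * s * cos w) / sin w ^+ 2.

Lemma cycloid_lower s w x v (L : R) : 0 < w < pi -> 0 <= s ->
  adm_path (0, 1) (cycloid_abs s w, s ^+ 2) x v -> path_length x v = L%:E ->
  cycloid_sqdist s w <= L ^+ 2.
Proof.
move=> wp s0 [[x0 v0] [x1 v1] cx cv dxv] HL; have /andP[w0 wpi] := wp.
have sw := sin_gt0_pi wp.
have cw t : 0 <= t <= 1 -> 0 < cos (w * (t - 2^-1)).
  by move=> /andP[t0 t1]; apply: cos_gt0_pihalf; apply/andP; split; nra.
(* This [k] makes the cycloid an integral curve of the gradient field of [u]. *)
pose k := w * (s - 1) / sin (w / 2).
have da t : 0 <= t <= 1 -> is_derive t 1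
    (fun t => - 4 * w * (sin (w * (t - 2^-1)) / cos (w * (t - 2^-1))))
    (- 4 * w ^+ 2 / cos (w * (t - 2^-1)) ^+ 2).
  move=> t01; have c0 := cw t t01; der; first by rewrite gt_eqF.
  have := cos2Dsin2 (w * (t - 2^-1)); set C := cos _ in c0 *; set S := sin _ => h.
  by have -> : - 4 * w ^+ 2 / C ^+ 2 = - 4 * w ^+ 2 * (C ^+ 2 + S ^+ 2) / C ^+ 2;
    [rewrite h mulr1|field; rewrite gt_eqF].
have db t : 0 <= t <= 1 -> is_derive t 1
    (fun t => 4 * k / cos (w * (t - 2^-1)))
    (4 * k * w * sin (w * (t - 2^-1)) / cos (w * (t - 2^-1)) ^+ 2).
  move=> t01; have c0 := cw t t01; der; first by rewrite gt_eqF.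
  by field; rewrite gt_eqF.
have dc t : 0 <= t <= 1 -> is_derive t 1
    (fun t => - k ^+ 2 / w * (sin (w * (t - 2^-1)) / cos (w * (t - 2^-1))))
    (- k ^+ 2 / cos (w * (t - 2^-1)) ^+ 2).
  move=> t01; have c0 := cw t t01; der; first by rewrite gt_eqF.
  have := cos2Dsin2 (w * (t - 2^-1)); set C := cos _ in c0 *; set S := sin _ => h.
  by have -> : - k ^+ 2 / C ^+ 2 = - k ^+ 2 * (C ^+ 2 + S ^+ 2) / C ^+ 2;
    [rewrite h mulr1|field; rewrite !gt_eqF].
have := calibration_le_length (m := 4 * w) da db dc _ cx cv dxv HL.
rewrite v0 v1 x0 x1 sqrtr1 sqrtr_sqr ger0_norm//.
have cw2 : 0 < cos (w / 2).
  by have := cw 1; rewrite lexx ler01 => /(_ isT); rewrite (_ : w * (1 - 2^-1) = w / 2)//; field.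
have sw2 : 0 < sin (w / 2) by apply: sin_gt0_pi; apply/andP; split; lra.
have e1 : w * (1 - 2^-1) = w / 2 by field.
have e0 : w * (0 - 2^-1) = - (w / 2) by field.
have sE : sin w = 2 * sin (w / 2) * cos (w / 2).
  by rewrite {1}(_ : w = (w / 2) *+ 2) ?sin_mulr2n; [ring|field].
have cE : cos w = 1 - 2 * sin (w / 2) ^+ 2.
  by rewrite {1}(_ : w = (w / 2) *+ 2) ?cos_mulr2n ?cos2sin2; [ring|field].
rewrite e1 e0 sinN cosN => h; apply: le_trans (h _); last first.
  move=> t r t01; have c0 := cw t t01.
  have := cos2Dsin2 (w * (t - 2^-1)); set C := cos _ in c0 *; set S := sin _ => hh.
  rewrite le_eqVlt; apply/orP; left; apply/eqP.
  have -> : - 4 * w ^+ 2 / C ^+ 2 = - 4 * w ^+ 2 * (C ^+ 2 + S ^+ 2) / C ^+ 2 by rewrite hh mulr1.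
  by field; rewrite gt_eqF.
rewrite le_eqVlt; apply/orP; left; apply/eqP.
rewrite /cycloid_sqdist /cycloid_abs /cpsi /cphi /k cE sE.
set C := cos (w / 2) in cw2 *; set S := sin (w / 2) in sw2 *.
by field; rewrite !gt_eqF.
Qed.

Lemma cycloid_path s w : 0 < w < pi -> 0 <= s ->
  exists x v, adm_path (0, 1) (cycloid_abs s w, s ^+ 2) x v /\
    forall t, 0 < t < 1 ->
      (derive1 x t ^+ 2 + derive1 v t ^+ 2) / v t = cycloid_sqdist s w.
Proof.
move=> wp s0; have /andP[w0 wpi] := wp; have sw := sin_gt0_pi wp.
pose p t := w * (1 - t); pose q t := w * t.
pose rho t := (sin (p t) + s * sin (q t)) / sin w.
pose rho' t := w * (s * cos (q t) - cos (p t)) / sin w.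
pose x t := (q t - sin w * cos w + sin (p t) * cos (p t)
  + 2 * s * (cos (p t) * sin (q t) - q t * cos w)
  + s ^+ 2 * (q t - sin (q t) * cos (q t))) / sin w ^+ 2.
have pq t : cos w = cos (p t) * cos (q t) - sin (p t) * sin (q t).
  by rewrite -cosD; congr cos; rewrite /p /q; ring.
have dx t : is_derive t 1 x (2 * w * rho t ^+ 2).
  rewrite /x /rho (pq t) /p /q; der.
  have := cos2Dsin2 (w * (1 - t)); have := cos2Dsin2 (w * t).
  set cp := cos (w * (1 - t)); set sp := sin (w * (1 - t)).
  set cq := cos (w * t); set sq := sin (w * t) => hq hp.
  transitivity ((w * (cp ^+ 2 + sp ^+ 2) + w * sp ^+ 2 - w * cp ^+ 2 + 4 * s * w * sp * sq
    + s ^+ 2 * (w * (cq ^+ 2 + sq ^+ 2) + w * sq ^+ 2 - w * cq ^+ 2)) / sin w ^+ 2).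
    by rewrite hp hq; field; rewrite gt_eqF.
  by field; rewrite gt_eqF.
have dv t : is_derive t 1 (fun t => rho t ^+ 2) (2 * rho t * rho' t).
  by rewrite /rho /rho' /p /q; der; field; rewrite gt_eqF.
have rho0 t : 0 < t < 1 -> 0 < rho t.
  move=> /andP[t0 t1]; rewrite divr_gt0// ltr_wpDr//.
    rewrite mulr_ge0// ltW// sin_gt0_pi// /q mulr_gt0//=.
    by rewrite (lt_trans _ wpi)// gtr_pMr.
  by rewrite sin_gt0_pi// /p mulr_gt0 ?subr_gt0//= (lt_trans _ wpi)// gtr_pMr// gtrBl.
exists x, (fun t => rho t ^+ 2); split.
  split.
  - rewrite /x /rho /p /q subr0 mulr1 mulr0 sin0 cos0.
    by congr pair; field; rewrite gt_eqF.
  - rewrite /x /rho /p /q subrr mulr1 mulr0 sin0 cos0 /cycloid_abs /cpsi /cphi.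
    by congr pair; field; rewrite gt_eqF.
  - by apply: continuous_subspaceT => t; exact: der_continuous (dx t).
  - by apply: continuous_subspaceT => t; exact: der_continuous (dv t).
  - move=> t t01; split; [by case: (dx t)|by case: (dv t)|].
    by rewrite exprn_gt0// rho0.
move=> t t01; have r0 := rho0 t t01.
rewrite !derive1E (@derive_val _ _ _ _ _ _ _ (dx t)) (@derive_val _ _ _ _ _ _ _ (dv t)).
have -> : ((2 * w * rho t ^+ 2) ^+ 2 + (2 * rho t * rho' t) ^+ 2) / rho t ^+ 2
  = 4 * (w ^+ 2 * rho t ^+ 2 + rho' t ^+ 2) by field; rewrite gt_eqF.
rewrite /cycloid_sqdist /rho /rho' (pq t).
have := cos2Dsin2 (p t); have := cos2Dsin2 (q t).
set cp := cos (p t); set sp := sin (p t).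
set cq := cos (q t); set sq := sin (q t) => hq hp.
have -> : 1 + s ^+ 2 - 2 * s * (cp * cq - sp * sq) =
  (cp ^+ 2 + sp ^+ 2) + s ^+ 2 * (cq ^+ 2 + sq ^+ 2) - 2 * s * (cp * cq - sp * sq).
  by rewrite hp hq mulr1.
by field; rewrite gt_eqF.
Qed.

Lemma dH_cycloid s w : 0 < w < pi -> 0 <= s ->
  dH (0, 1) (cycloid_abs s w, s ^+ 2) = (Num.sqrt (cycloid_sqdist s w))%:E.
Proof.
move=> wp s0; apply: dH_eq; last exact: cycloid_path.
by move=> x v L; exact: cycloid_lower.
Qed.

End heston_distance.

Section inverse_functions.
Context {R : realType}.
Implicit Types (t w y al b g s : R).

Lemma homo_mono_le (f : R -> R) (B : R) :
  (forall x y, 0 < x -> x < y -> y < B -> f x < f y) ->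
  forall x y, 0 < x < B -> 0 < y < B -> (f x <= f y) = (x <= y).
Proof.
move=> fh x y /andP[x0 xB] /andP[y0 yB]; have [xy|yx|->] := ltgtP x y.
- by rewrite ltW// fh.
- by apply/negbTE; rewrite -ltNge fh.
- by rewrite lexx.
Qed.

Lemma half_angle t : [/\ 1 - cos t = 2 * sin (t / 2) ^+ 2,
  sin t = 2 * sin (t / 2) * cos (t / 2) & t = 2 * (t / 2)].
Proof.
have tE : t = (t / 2) *+ 2 by field.
split; last by field.
- by rewrite {1}tE cos_mulr2n cos2sin2; ring.
- by rewrite {1}tE sin_mulr2n; ring.
Qed.

Lemma doubleK w : 2 * w / 2 = w.
Proof. by rewrite mulrC mulKf. Qed.

Lemma halfP t : 0 < t < 2 * pi -> 0 < t / 2 < pi.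
Proof. by move=> /andP[t0 t2]; apply/andP; split; lra. Qed.

Lemma psiE t : 0 < t < 2 * pi -> psi t = cpsi (t / 2).
Proof.
move=> /halfP wp; have s0 := sin_gt0_pi wp; have [cE sE tE] := half_angle t.
by rewrite /psi cE sE {1}tE /cpsi; field; rewrite gt_eqF.
Qed.

Lemma sub_sin_gt0 w : 0 < w < pi -> 0 < w - sin w * cos w.
Proof.
move=> wp; have := cpsi_gt0 wp; rewrite /cpsi pmulr_lgt0//.
by rewrite invr_gt0 exprn_gt0// sin_gt0_pi.
Qed.

Lemma AfunE t : 0 < t < 2 * pi -> Afun t = - cphi (t / 2) / cpsi (t / 2).
Proof.
move=> /halfP wp; have s0 := sin_gt0_pi wp; have [cE sE tE] := half_angle t.
have n0 := sub_sin_gt0 wp; have m0 : 0 < t - sin t by rewrite sE {1}tE; lra.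
have -> : Afun t = (2 * (t / 2) * cos (t / 2) - 2 * sin (t / 2)) /
    (2 * (t / 2) - 2 * sin (t / 2) * cos (t / 2)) by rewrite -tE /Afun sE.
rewrite /cphi /cpsi; field; rewrite gt_eqF//= gt_eqF//; lra.
Qed.

Lemma BfunE t : 0 < t < 2 * pi -> Bfun t = (cpsi (t / 2))^-1.
Proof. by move=> tp; rewrite -psiE// /psi invf_div. Qed.

Lemma etaE t : 0 < t < 2 * pi -> eta t = cpsi (t / 2) + cphi (t / 2).
Proof.
move=> tp; rewrite /eta psiE// AfunE//; have := cpsi_gt0 (halfP tp) => p0.
by field; rewrite gt_eqF.
Qed.

Lemma eta_alE al t : 0 < t < 2 * pi ->
  eta_al al t = cphi (t / 2) ^+ 2 / (al - cpsi (t / 2)) + cpsi (t / 2).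
Proof.
move=> tp; have p0 := cpsi_gt0 (halfP tp).
rewrite /eta_al psiE// AfunE// -exprMn -(sqrrN (cphi _)); congr (_ ^+ 2 / _ + _).
by field; rewrite gt_eqF.
Qed.

Lemma continuous_cpsi w : 0 < w < pi -> {for w, continuous cpsi}.
Proof. by move=> /der_cpsi; exact: der_continuous. Qed.

Lemma continuous_cphi w : 0 < w < pi -> {for w, continuous cphi}.
Proof. by move=> /der_cphi; exact: der_continuous. Qed.

Lemma cpsi_surj y : 0 < y -> exists2 w, 0 < w < pi & cpsi w = y.
Proof.
move=> y0; have [w1 /andP[a1 b1] h1] := cpsi_small y0; have [w2 /andP[a2 b2] h2] := cpsi_large y.
have w12 : w1 <= w2 by rewrite -(homo_mono_le cpsi_homo) ?a1 ?a2//; lra.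
have [||w /andP[l1 l2] <-] := @IVT_oo R cpsi 0 pi w1 w2 y a1 w12 b2; last first.
- by exists w => //; rewrite (lt_le_trans a1 l1) (le_lt_trans l2 b2).
- by rewrite (ltW h1) (ltW h2).
- exact: continuous_cpsi.
Qed.

Lemma psi_invP y : 0 < y -> 0 < psi_inv y < 2 * pi /\ cpsi (psi_inv y / 2) = y.
Proof.
move=> y0; have [w /andP[w0 wp] wy] := cpsi_surj y0.
have H : exists t, 0 < t < 2 * pi /\ psi t = y.
  have tp : 0 < 2 * w < 2 * pi by apply/andP; split; lra.
  exists (2 * w); split => //; rewrite psiE//.
  by rewrite doubleK.
by have [tp e] := getPex H; split => //; rewrite -psiE.
Qed.

Lemma ge_psi_inv y t : 0 < y -> 0 < t < 2 * pi -> (psi_inv y <= t) = (y <= cpsi (t / 2)).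
Proof.
move=> y0 tp; have [yp e] := psi_invP y0; rewrite -[in RHS]e.
by rewrite (homo_mono_le cpsi_homo) ?halfP// ler_pM2r.
Qed.

Lemma le_psi_inv y t : 0 < y -> 0 < t < 2 * pi -> (t <= psi_inv y) = (cpsi (t / 2) <= y).
Proof.
move=> y0 tp; have [yp e] := psi_invP y0; rewrite -[in RHS]e.
by rewrite (homo_mono_le cpsi_homo) ?halfP// ler_pM2r.
Qed.

Lemma lt_psi_inv y t : 0 < y -> 0 < t < 2 * pi -> (t < psi_inv y) = (cpsi (t / 2) < y).
Proof. by move=> y0 tp; rewrite !ltNge ge_psi_inv. Qed.

Lemma eta_homo w w' : 0 < w -> w < w' -> w' < pi ->
  cpsi w + cphi w < cpsi w' + cphi w'.
Proof. by move=> w0 ww wp; apply: ltrD; [exact: cpsi_homo|exact: cphi_homo]. Qed.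

Lemma eta_surj y : 0 < y -> exists2 w, 0 < w < pi & cpsi w + cphi w = y.
Proof.
move=> y0; have y20 : 0 < y / 2 by rewrite divr_gt0.
have [w1 w1p h1] := cpsi_small y20; have [w2 w2p h2] := cpsi_large y.
have k1 := cphi_lt_cpsi w1p; have k2 := cphi_gt0 w2p.
case/andP: (w1p) => a1 b1; case/andP: (w2p) => a2 b2.
have w12 : w1 <= w2 by rewrite -(homo_mono_le cpsi_homo)//; lra.
have [||w /andP[l1 l2] <-] := @IVT_oo R (fun w => cpsi w + cphi w) 0 pi w1 w2 y a1 w12 b2; last first.
- by exists w => //; rewrite (lt_le_trans a1 l1) (le_lt_trans l2 b2).
- by apply/andP; split; lra.
- by move=> w wp; apply: continuousD; [exact: continuous_cpsi|exact: continuous_cphi].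
Qed.

Lemma eta_invP y : 0 < y -> 0 < eta_inv y < 2 * pi /\
  cpsi (eta_inv y / 2) + cphi (eta_inv y / 2) = y.
Proof.
move=> y0; have [w /andP[w0 wp] wy] := eta_surj y0.
have H : exists t, 0 < t < 2 * pi /\ eta t = y.
  have tp : 0 < 2 * w < 2 * pi by apply/andP; split; lra.
  exists (2 * w); split => //; rewrite etaE//.
  by rewrite doubleK.
by have [tp e] := getPex H; split => //; rewrite -etaE.
Qed.

Lemma ge_eta_inv y t : 0 < y -> 0 < t < 2 * pi ->
  (eta_inv y <= t) = (y <= cpsi (t / 2) + cphi (t / 2)).
Proof.
move=> y0 tp; have [yp e] := eta_invP y0; rewrite -[in RHS]e.
by rewrite (homo_mono_le eta_homo) ?halfP// ler_pM2r.
Qed.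

(* [eta_al] at [theta = 2 w]. *)
Definition ceta al w := cphi w ^+ 2 / (al - cpsi w) + cpsi w.

Lemma ceta_homo al w w' : 0 < w -> w < w' -> w' < pi -> cpsi w' < al ->
  ceta al w < ceta al w'.
Proof.
move=> w0 ww wp al'; have pw := cpsi_homo w0 ww wp; have fw := cphi_homo w0 ww wp.
have f0 : 0 < cphi w by rewrite cphi_gt0// w0 (lt_trans ww wp).
apply: ler_ltD => //; apply: ler_pM; rewrite ?sqr_ge0//.
- by rewrite invr_ge0; lra.
- by rewrite ler_sqr ?nnegrE ?ltW// (lt_trans f0 fw).
- by rewrite lef_pV2 ?posrE; lra.
Qed.

Lemma ceta_surj al y : 0 < y -> y < al ->
  exists w, [/\ 0 < w < pi, cpsi w < al & ceta al w = y].
Proof.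
move=> y0 yal; have al0 := lt_trans y0 yal.
have [w2 w2p h2] : exists2 w, 0 < w < pi & cpsi w = (y + al) / 2 by apply: cpsi_surj; lra.
have [w1 w1p h1] : exists2 w, 0 < w < pi & cpsi w < y / 3.
  by apply: cpsi_small; rewrite divr_gt0.
have k1 := cphi_lt_cpsi w1p; have f1 := cphi_gt0 w1p.
case/andP: (w1p) => a1 b1; case/andP: (w2p) => a2 b2.
have w12 : w1 <= w2 by rewrite -(homo_mono_le cpsi_homo)//; lra.
have dom w : w1 <= w -> w <= w2 -> 0 < w < pi /\ cpsi w < al.
  move=> l1 l2; have wp : 0 < w < pi by rewrite (lt_le_trans a1 l1) (le_lt_trans l2 b2).
  by split => //; move: l2; rewrite -(homo_mono_le cpsi_homo) ?h2//; lra.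
have [||w] := @IVT R (ceta al) w1 w2 y w12.
- apply: continuous_in_subspaceT => w; rewrite inE/= in_itv/= => /andP[l1 l2].
  have [wp wal] := dom w l1 l2.
  have n0 : al - cpsi w != 0 by rewrite gt_eqF// subr_gt0.
  have d1 := der_cpsi wp; have d2 := der_cphi wp.
  exact: (der_continuous (derD (derM (derX 2 d2) (derV (derD (derC w al) (derN d1)) n0)) d1)).
- rewrite ge_min le_max; apply/andP; split; apply/orP; [left|right].
    have : cphi w1 ^+ 2 / (al - cpsi w1) <= cpsi w1.
      by rewrite ler_pdivrMr; [nra|lra].
    by rewrite /ceta; lra.
  have : 0 <= cphi w2 ^+ 2 / (al - cpsi w2) by rewrite divr_ge0 ?sqr_ge0// h2; lra.
  by rewrite /ceta h2; lra.
- rewrite in_itv/= => /andP[l1 l2] <-; exists w; have [wp wal] := dom w l1 l2.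
  by split.
Qed.

Lemma eta_al_invP al y : 0 < y -> y < al -> 0 < eta_al_inv al y < psi_inv al /\
  ceta al (eta_al_inv al y / 2) = y.
Proof.
move=> y0 yal; have al0 := lt_trans y0 yal.
have [w [/andP[w0 wp] wal wy]] := ceta_surj y0 yal.
have [/andP[al1 al2] _] := psi_invP al0.
have H : exists t, 0 < t < psi_inv al /\ eta_al al t = y.
  have tp : 0 < 2 * w < 2 * pi by apply/andP; split; lra.
  exists (2 * w); split; last by rewrite eta_alE// doubleK.
  by rewrite lt_psi_inv// doubleK wal mulr_gt0.
have [tp e] := getPex H; split => //.
by rewrite /ceta -eta_alE//; case/andP: tp => -> /lt_trans->.
Qed.

Lemma ge_eta_al_inv al y t : 0 < y -> y < al -> 0 < t < psi_inv al ->
  (eta_al_inv al y <= t) = (y <= ceta al (t / 2)).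
Proof.
move=> y0 yal tp; have al0 := lt_trans y0 yal.
have [/andP[al1 al2] _] := psi_invP al0.
have [yp e] := eta_al_invP y0 yal; rewrite -[in RHS]e.
rewrite (@homo_mono_le _ (psi_inv al / 2)).
- by rewrite ler_pM2r.
- move=> w w' w0 ww wal; apply: ceta_homo => //; first by lra.
  by rewrite -(doubleK w') -lt_psi_inv//; [lra|apply/andP; split; lra].
- by case/andP: yp => *; apply/andP; split; lra.
- by case/andP: tp => *; apply/andP; split; lra.
Qed.

End inverse_functions.

Section quadratic_roots.
Context {R : realType}.
Implicit Types (D P E s : R).

Lemma quadratic_rootP D P E s : D != 0 -> D * s ^+ 2 + 2 * P * s + E = 0 ->
  0 <= P ^+ 2 - D * E /\ (s = (- P + Num.sqrt (P ^+ 2 - D * E)) / D \/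
                          s = (- P - Num.sqrt (P ^+ 2 - D * E)) / D).
Proof.
move=> D0 h; have e : P ^+ 2 - D * E = (D * s + P) ^+ 2.
  by rewrite -[LHS]addr0 -(mulr0 D) -h; ring.
rewrite e; split; first exact: sqr_ge0.
rewrite sqrtr_sqr; have [k|k] := leP 0 (D * s + P).
  by left; rewrite ger0_norm//; field.
by right; rewrite ltr0_norm//; field.
Qed.

Lemma quadratic_root (e : R) D P E : e ^+ 2 = 1 -> D != 0 -> 0 <= P ^+ 2 - D * E ->
  let s := (- P + e * Num.sqrt (P ^+ 2 - D * E)) / D in
  D * s ^+ 2 + 2 * P * s + E = 0.
Proof.
move=> e1 D0 /sqr_sqrtr; set r := Num.sqrt _ => h s.
have -> : D * s ^+ 2 + 2 * P * s + E = (e ^+ 2 * r ^+ 2 - (P ^+ 2 - D * E)) / D.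
  by rewrite /s; field.
by rewrite e1 h mul1r subrr mul0r.
Qed.

Lemma sqrt_le_coef D P E : 0 < P -> 0 <= D * E ->
  Num.sqrt (P ^+ 2 - D * E) <= P.
Proof.
move=> P0 DE; rewrite -[leRHS](ger0_norm (ltW P0)) -sqrtr_sqr.
by rewrite ler_wsqrtr// gerBl.
Qed.

Lemma sqrt_ge_coef D P E : 0 < P -> D * E <= 0 ->
  P <= Num.sqrt (P ^+ 2 - D * E).
Proof.
move=> P0 DE; rewrite -[leLHS](ger0_norm (ltW P0)) -sqrtr_sqr.
by rewrite ler_wsqrtr// lerDl oppr_ge0.
Qed.

Lemma sqrt_gt_coef D P E : 0 < P -> D * E < 0 ->
  P < Num.sqrt (P ^+ 2 - D * E).
Proof.
move=> P0 DE; rewrite -[ltLHS](ger0_norm (ltW P0)) -sqrtr_sqr.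
rewrite ltr_sqrt; first by rewrite ltrDl oppr_gt0.
by have := exprn_gt0 2 P0; lra.
Qed.

End quadratic_roots.

Section distance_to_line.
Context {R : realType}.
Implicit Types (t w y al b g s : R).

Definition disc b g t := cphi (t / 2) ^+ 2 - (cpsi (t / 2) - g) * (cpsi (t / 2) - b).

Lemma Lam_rawE (S : R -> R) t : 0 < t < 2 * pi ->
  Lam_raw S t = cycloid_sqdist (S t) (t / 2) / 2.
Proof.
move=> /halfP wp; have s0 := sin_gt0_pi wp; have [cE _ tE] := half_angle t.
have -> : Lam_raw S t =
    (2 * (t / 2)) ^+ 2 / (1 - cos t) * (S t ^+ 2 + 1 - 2 * S t * cos (t / 2)).
  by rewrite -tE.
by rewrite cE /cycloid_sqdist; field; rewrite gt_eqF.
Qed.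

Let discE b g t : 0 < t < 2 * pi ->
  Num.sqrt (Afun t ^+ 2 - (1 - g * Bfun t) * (1 - b * Bfun t)) =
  Num.sqrt (disc b g t) / cpsi (t / 2).
Proof.
move=> tp; have p0 := cpsi_gt0 (halfP tp).
have -> : Afun t ^+ 2 - (1 - g * Bfun t) * (1 - b * Bfun t) =
    disc b g t * (cpsi (t / 2))^-1 ^+ 2.
  by rewrite AfunE// BfunE// /disc; field; rewrite gt_eqF.
by rewrite mulrC sqrtrM ?sqr_ge0// sqrtr_sqr gtr0_norm ?invr_gt0// mulrC.
Qed.

Lemma S_plusE b g t : 0 < t < 2 * pi -> S_plus b g t =
  if cpsi (t / 2) == g then (b - cpsi (t / 2)) / (2 * cphi (t / 2))
  else (- cphi (t / 2) + Num.sqrt (disc b g t)) / (cpsi (t / 2) - g).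
Proof.
move=> tp; have p0 := cpsi_gt0 (halfP tp); have f0 := cphi_gt0 (halfP tp).
rewrite /S_plus discE// AfunE// BfunE//.
have -> : 1 - g * (cpsi (t / 2))^-1 = (cpsi (t / 2) - g) / cpsi (t / 2).
  by field; rewrite gt_eqF.
rewrite mulf_eq0 invr_eq0 [cpsi _ == 0]gt_eqF// orbF subr_eq0.
case: eqVneq => [_|n]; first by field; rewrite !gt_eqF.
by field; rewrite subr_eq0 n/= gt_eqF.
Qed.

Lemma S_minusE b g t : 0 < t < 2 * pi -> cpsi (t / 2) != g -> S_minus b g t =
  (- cphi (t / 2) - Num.sqrt (disc b g t)) / (cpsi (t / 2) - g).
Proof.
move=> tp n; have p0 := cpsi_gt0 (halfP tp).
rewrite /S_minus discE// AfunE// BfunE//.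
have -> : 1 - g * (cpsi (t / 2))^-1 = (cpsi (t / 2) - g) / cpsi (t / 2).
  by field; rewrite gt_eqF.
by field; rewrite subr_eq0 n/= gt_eqF.
Qed.

Definition feasible b g s t :=
  [/\ 0 < t < 2 * pi, 0 <= s & cycloid_abs s (t / 2) = b + g * s ^+ 2].

Lemma cycloid_absP b g s w : cycloid_abs s w = b + g * s ^+ 2 <->
  (cpsi w - g) * s ^+ 2 + 2 * cphi w * s + (cpsi w - b) = 0.
Proof. by rewrite /cycloid_abs; split => h; lra. Qed.

Lemma cycloid_sqdist_ge0 s w : 0 <= cycloid_sqdist s w.
Proof.
apply: divr_ge0; last exact: sqr_ge0.
apply: mulr_ge0; first by rewrite mulr_ge0 ?sqr_ge0.
have -> : 1 + s ^+ 2 - 2 * s * cos w = (s - cos w) ^+ 2 + sin w ^+ 2.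
  by have := cos2Dsin2 w; lra.
by rewrite addr_ge0 ?sqr_ge0.
Qed.

Lemma feasible_dist b g s t : feasible b g s t ->
  ((2^-1)%:E * dH (0%R, 1%R) (b + g * s ^+ 2, s ^+ 2)%R ^+ 2 =
   (cycloid_sqdist s (t / 2) / 2)%:E)%E.
Proof.
move=> [/halfP wp s0 <-]; rewrite dH_cycloid// -EFin_expe -EFinM.
by rewrite sqr_sqrtr ?cycloid_sqdist_ge0// mulrC.
Qed.

Lemma feasible_exists b g s : 0 <= s -> 0 < b + g * s ^+ 2 ->
  exists t, feasible b g s t.
Proof.
move=> s0; set X := b + _ => X0.
have s1 : 0 < (1 + s) ^+ 2 by rewrite exprn_gt0// ltr_wpDr.
have [w1 w1p h1] := cpsi_small (divr_gt0 X0 s1); have [w2 w2p h2] := cpsi_large X.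
have k1 := cphi_lt_cpsi w1p; have k2 := cphi_gt0 w2p; have k2' := cpsi_gt0 w2p.
rewrite ltr_pdivlMr// in h1.
have w12 : w1 <= w2.
  have [//|ww] := leP w1 w2.
  have := cpsi_homo (ltac:(by case/andP: w2p) : 0 < w2) ww (ltac:(by case/andP: w1p)).
  nra.
case/andP: (w1p) => a1 b1; case/andP: (w2p) => a2 b2.
have [||w /andP[l1 l2] wX] := @IVT_oo R (cycloid_abs s) 0 pi w1 w2 X a1 w12 b2.
- move=> w wp; apply: (@continuousD _ _ _ (fun w => cpsi w * (1 + s ^+ 2)) (fun w => 2 * s * cphi w)).
    by apply: continuousM; [exact: continuous_cpsi|exact: cst_continuous].
  by apply: continuousM; [exact: cst_continuous|exact: continuous_cphi].
- rewrite /cycloid_abs; apply/andP; split; first nra.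
  have := mulr_ge0 s0 (ltW k2); have := mulr_ge0 (ltW k2') (sqr_ge0 s); lra.
exists (2 * w); split => //; last by rewrite doubleK.
by apply/andP; split; lra.
Qed.

Lemma Dbg_inf b g (V : set R) : (forall y, V y -> 0 <= y) ->
  (forall y, V y -> exists2 w, 0 <= w &
     ((2^-1)%:E * dH (0%R, 1%R) (b + g * w, w)%R ^+ 2 = y%:E)%E) ->
  (forall w, 0 <= w -> exists2 y, V y &
     ((2^-1)%:E * dH (0%R, 1%R) (b + g * w, w)%R ^+ 2 = y%:E)%E) ->
  Dbg b g = (inf V)%:E.
Proof.
move=> V0 Vd dV; rewrite -ereal_inf_EFin; last 2 first.
- by exists 0 => y /V0.
- by have [y Vy _] := dV 0 (lexx 0); exists y.
rewrite /Dbg; congr ereal_inf; apply/seteqP; split => [_ [w /= w0 <-]|_ [y Vy <-]].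
  by have [y Vy ->] := dV w w0; exists y.
by have [w w0 <-] := Vd y Vy; exists w.
Qed.

Lemma inf_setU_min (A B : set R) : A !=set0 -> B !=set0 ->
  has_lbound A -> has_lbound B -> inf (A `|` B) = Num.min (inf A) (inf B).
Proof.
move=> A0 B0 lA lB; have [a la] := lA; have [b lb] := lB.
have lAB : has_lbound (A `|` B).
  exists (Num.min a b) => y; rewrite ge_min.
  by case=> [/la|/lb] ->; rewrite ?orbT.
apply/eqP; rewrite eq_le; apply/andP; split.
  rewrite le_min; apply/andP; split.
    by apply: lb_le_inf => // y Ay; apply: ge_inf => //; left.
  by apply: lb_le_inf => // y By; apply: ge_inf => //; right.
apply: lb_le_inf; first by case: A0 => y Ay; exists y; left.
move=> y [Ay|By]; rewrite ge_min; apply/orP; [left|right]; exact: ge_inf.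
Qed.

Lemma Dbg_branches b g (Ip Im : set R) : 0 < b -> 0 < g ->
  (forall t, Ip t -> feasible b g (S_plus b g t) t) ->
  (forall t, Im t -> feasible b g (S_minus b g t) t) ->
  (forall s t, feasible b g s t ->
     Ip t /\ s = S_plus b g t \/ Im t /\ s = S_minus b g t) ->
  Ip !=set0 -> Im !=set0 ->
  Dbg b g = (Num.min (inf [set Lambda_plus b g t | t in Ip])
                     (inf [set Lambda_minus b g t | t in Im]))%:E.
Proof.
move=> b0 g0 fp fm fs Ip0 Im0.
have LpE t : Ip t -> Lambda_plus b g t = cycloid_sqdist (S_plus b g t) (t / 2) / 2.
  move=> /fp[tp _ _]; rewrite /Lambda_plus; case/andP: (tp) => t0 _.
  by rewrite gt_eqF// Lam_rawE.
have LmE t : Im t -> Lambda_minus b g t = cycloid_sqdist (S_minus b g t) (t / 2) / 2.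
  move=> /fm[tp _ _]; rewrite /Lambda_minus; case/andP: (tp) => t0 _.
  by rewrite gt_eqF// Lam_rawE.
have half_ge0 s w : 0 <= cycloid_sqdist s w / 2.
  by rewrite divr_ge0// cycloid_sqdist_ge0.
rewrite -inf_setU_min.
- apply: Dbg_inf.
  + by move=> y [[t It <-]|[t It <-]]; rewrite ?LpE ?LmE.
  + move=> y [[t It <-]|[t It <-]].
      by exists (S_plus b g t ^+ 2); [exact: sqr_ge0|rewrite (feasible_dist (fp t It)) LpE].
    by exists (S_minus b g t ^+ 2); [exact: sqr_ge0|rewrite (feasible_dist (fm t It)) LmE].
  + move=> w w0.
    have [|t ft] := @feasible_exists b g (Num.sqrt w) (sqrtr_ge0 _).
      by rewrite ltr_wpDr// mulr_ge0 ?sqr_ge0// ltW.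
    have := feasible_dist ft; rewrite sqr_sqrtr// => ->.
    have [[It sE]|[It sE]] := fs _ _ ft.
      by exists (Lambda_plus b g t); [left; exists t|rewrite LpE// sE].
    by exists (Lambda_minus b g t); [right; exists t|rewrite LmE// sE].
- by case: Ip0 => t It; exists (Lambda_plus b g t), t.
- by case: Im0 => t It; exists (Lambda_minus b g t), t.
- by exists 0 => _ [t It <-]; rewrite LpE.
- by exists 0 => _ [t It <-]; rewrite LmE.
Qed.

End distance_to_line.

Section branches.
Context {R : realType}.
Implicit Types (t w y al b g s : R).

Lemma feasible_plus b g t : 0 < t < 2 * pi -> cpsi (t / 2) <= b ->
  0 <= disc b g t -> feasible b g (S_plus b g t) t.
Proof.
move=> tp pb d0; have f0 := cphi_gt0 (halfP tp).
rewrite S_plusE//; case: eqVneq => [pg|n]; split => //.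
- by rewrite divr_ge0 ?subr_ge0// mulr_ge0// ltW.
- by apply/cycloid_absP; rewrite pg; field; rewrite gt_eqF.
- have [pg|gp] := ltP (cpsi (t / 2)) g.
    rewrite ler_ndivlMr ?subr_lt0// mul0r addrC subr_le0 sqrt_le_coef//.
    by rewrite mulr_le0 ?subr_le0// ltW.
  rewrite divr_ge0 ?subr_ge0// addrC subr_ge0 sqrt_ge_coef//.
  by rewrite mulr_ge0_le0 ?subr_ge0 ?subr_le0.
- apply/cycloid_absP.
  have := @quadratic_root R 1 (cpsi (t / 2) - g) (cphi (t / 2)) (cpsi (t / 2) - b).
  by rewrite mul1r expr1n subr_eq0; exact.
Qed.

Lemma S_minus_ge0 b g t : 0 < t < 2 * pi -> cpsi (t / 2) < g -> 0 <= S_minus b g t.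
Proof.
move=> tp pg; have f0 := cphi_gt0 (halfP tp); rewrite S_minusE ?lt_eqF//.
rewrite ler_ndivlMr ?subr_lt0// mul0r subr_le0.
by apply: le_trans (sqrtr_ge0 _); rewrite oppr_le0 ltW.
Qed.

Lemma feasible_minus b g t : 0 < t < 2 * pi -> cpsi (t / 2) < g ->
  0 <= disc b g t -> feasible b g (S_minus b g t) t.
Proof.
move=> tp pg d0; split => //; first exact: S_minus_ge0.
apply/cycloid_absP; rewrite S_minusE ?lt_eqF//.
have := @quadratic_root R (-1) (cpsi (t / 2) - g) (cphi (t / 2)) (cpsi (t / 2) - b).
by rewrite mulN1r sqrrN expr1n subr_eq0 lt_eqF//; exact.
Qed.

Lemma feasible_branch b g s t : feasible b g s t -> 0 <= disc b g t /\
  (cpsi (t / 2) <= b /\ s = S_plus b g t \/ cpsi (t / 2) < g /\ s = S_minus b g t).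
Proof.
move=> [tp s0 /cycloid_absP h]; have f0 := cphi_gt0 (halfP tp).
rewrite S_plusE//.
have [pg|gp|pg] := ltgtP (cpsi (t / 2)) g.
- have n : cpsi (t / 2) - g != 0 by rewrite subr_eq0 lt_eqF.
  have [d0 sE] := quadratic_rootP n h; split => //.
  case: sE => sE; [left|by right; rewrite S_minusE ?lt_eqF]; split => //.
  rewrite leNgt; apply/negP => bp; move: s0; rewrite sE leNgt; apply/negP/negPn.
  rewrite ltr_ndivrMr ?subr_lt0// mul0r addrC subr_gt0 sqrt_gt_coef//.
  by rewrite nmulr_rlt0 ?subr_lt0 ?subr_gt0.
- have n : cpsi (t / 2) - g != 0 by rewrite subr_eq0 gt_eqF.
  have [d0 sE] := quadratic_rootP n h; split => //; left.
  have g0 : 0 < cpsi (t / 2) - g by rewrite subr_gt0.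
  split; first by have := mulr_ge0 (ltW f0) s0; have := mulr_ge0 (ltW g0) (sqr_ge0 s); lra.
  case: sE => // sE; move: s0; rewrite sE leNgt => /negP; case.
  rewrite ltr_pdivrMr// mul0r subr_lt0; apply: lt_le_trans (sqrtr_ge0 _).
  by rewrite oppr_lt0.
- rewrite pg subrr mul0r add0r in h; have := mulr_ge0 (ltW f0) s0 => fs.
  rewrite /disc pg subrr mul0r subr0 sqr_ge0; split => //; left; split; first by lra.
  apply: (mulfI (_ : 2 * cphi (t / 2) != 0)); first by rewrite gt_eqF// mulr_gt0.
  by rewrite [RHS]mulrC divfK; [lra|rewrite gt_eqF// mulr_gt0].
Qed.

Lemma eta_inv_disc b t : 0 < b -> 0 < t < 2 * pi -> cpsi (t / 2) <= b ->
  (eta_inv b <= t) = (0 <= disc b b t).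
Proof.
move=> b0 tp pb; have f0 := cphi_gt0 (halfP tp).
rewrite ge_eta_inv// /disc -expr2 subr_ge0 -sqrrN opprB ler_sqr ?nnegrE ?subr_ge0 ?(ltW f0)//.
by rewrite lerBlDl.
Qed.

Lemma eta_al_inv_disc al y t : 0 < y -> y < al -> 0 < t < 2 * pi ->
  cpsi (t / 2) < al -> (eta_al_inv al y <= t) = (0 <= disc y al t).
Proof.
move=> y0 yal tp pal; have al0 := lt_trans y0 yal.
rewrite ge_eta_al_inv//; last by rewrite lt_psi_inv// pal; case/andP: tp => ->.
rewrite /ceta -lerBlDr ler_pdivlMr ?subr_gt0// /disc subr_ge0.
by congr (_ <= _); ring.
Qed.

Lemma discC b g t : disc b g t = disc g b t.
Proof. by rewrite /disc [_ * (_ - b)]mulrC. Qed.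

End branches.

Section limit_at_origin.
Context {R : realType}.
Implicit Types (t w g e : R).

Lemma Lambda_minus0 g : 0 < g -> Lambda_minus 0 g 0 = 2 :> R.
Proof.
move=> g0; rewrite /Lambda_minus eqxx; apply/cvg_lim => //.
have FF : Filter ((0 : R)^'+) by exact: at_right_proper_filter.
have pi0 := pi_gt0 R.
have small e : 0 < e -> \forall t \near (0:R)^'+, 0 < t < 2 * pi /\ cpsi (t / 2) < e.
  move=> e0; have [w /andP[w0 wp] we] := cpsi_small e0; near=> t.
  have t0 : 0 < t by near: t; exact: nbhs_right_gt.
  have tw : t < 2 * w by near: t; apply: nbhs_right_lt; rewrite mulr_gt0.
  split; first by apply/andP; split; lra.
  by apply: lt_trans we; apply: cpsi_homo => //; lra.
have cp : cpsi (t / 2) @[t --> (0:R)^'+] --> (0 : R).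
  apply/cvgrPdist_lt => e e0; apply: filterS (small e e0) => t [tp te].
  by rewrite sub0r normrN gtr0_norm// cpsi_gt0// halfP.
have cf : cphi (t / 2) @[t --> (0:R)^'+] --> (0 : R).
  apply/cvgrPdist_lt => e e0; apply: filterS (small e e0) => t [tp te].
  rewrite sub0r normrN gtr0_norm ?cphi_gt0 ?halfP//.
  by apply: lt_trans te; rewrite cphi_lt_cpsi// halfP.
have ct : (t / 2 : R) @[t --> (0:R)^'+] --> (0 : R).
  by rewrite -[X in _ --> X](mul0r 2^-1); apply: cvgMr_tmp; exact: cvg_within.
have nt : \forall t \near (0:R)^'+, t / 2 != 0 :> R.
  by apply: filterS (small 1 ltr01) => t [/halfP/andP[t0 _] _]; rewrite gt_eqF.
have csin : (sin (t / 2) - sin 0) / (t / 2 - 0) @[t --> (0:R)^'+] --> cos (0 : R).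
  exact: (cvg_der_quotient FF (is_derive_sin 0) ct nt).
rewrite cos0 in csin.
have ccos : cos (t / 2) @[t --> (0:R)^'+] --> (1 : R).
  by have := cvg_comp _ _ ct (@continuous_cos R 0); rewrite cos0.
pose r t := cphi (t / 2) ^+ 2 - (cpsi (t / 2) - g) * (cpsi (t / 2) - 0).
pose S t : R := (- cphi (t / 2) - Num.sqrt (r t)) / (cpsi (t / 2) - g).
have cD : cpsi (t / 2) - g @[t --> (0:R)^'+] --> 0 - g by exact: (cvgB cp (cvg_cst g)).
have cr : r t @[t --> (0:R)^'+] --> 0 * 0 - (0 - g) * (0 - 0 : R).
  exact: (cvgB (cvgM cf cf) (cvgM cD (cvgB cp (cvg_cst 0)))).
rewrite (_ : 0 * 0 - _ = 0) in cr; last by ring.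
have csr := cvg_comp _ _ cr (@sqrt_continuous R _).
rewrite sqrtr0 in csr.
have g1 : 0 - g != 0 by rewrite sub0r oppr_eq0 gt_eqF.
have cS : S t @[t --> (0:R)^'+] --> (- 0 - 0) / (0 - g).
  exact: (cvgM (cvgB (cvgN cf) csr) (cvgV g1 cD)).
rewrite oppr0 addr0 mul0r in cS.
pose u t := ((sin (t / 2) - sin 0) / (t / 2 - 0))^-1.
pose Q t : R := 2 * (u t * u t) *
  (1 + S t * S t - 2 * S t * cos (t / 2)).
have cQ : Q t @[t --> (0:R)^'+] --> 2 * (1^-1 * 1^-1) * (1 + 0 * 0 - 2 * 0 * 1 : R).
  have ci : u t @[t --> (0:R)^'+] --> (1^-1 : R) by exact: (cvgV (oner_neq0 R) csin).
  exact: (cvgM (cvgM (cvg_cst (2 : R)) (cvgM ci ci))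
    (cvgB (cvgD (cvg_cst (1 : R)) (cvgM cS cS)) (cvgM (cvgM (cvg_cst (2 : R)) cS) ccos))).
rewrite (_ : 2 * _ * _ = 2) in cQ; last by field.
apply: cvg_trans cQ; apply: near_eq_cvg.
apply: filterS (small g g0) => t [tp pg].
have s0 := sin_gt0_pi (halfP tp); have /andP[t0 _] := halfP tp.
rewrite Lam_rawE// S_minusE ?lt_eqF// -/(r t) -/(S t) /Q /u sin0 !subr0 /cycloid_sqdist.
by field; rewrite gt_eqF//= gt_eqF//; case/andP: tp.
Unshelve. all: by end_near. Qed.

End limit_at_origin.

Theorem theorem3p1 (R : realType) :
  [/\ (forall b : R, 0 < b ->
        Dbg b b =
        (Num.min
           (inf [set Lambda_plus b b t | t in `[eta_inv b, psi_inv b]])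
           (inf [set Lambda_minus b b t | t in `[eta_inv b, psi_inv b[]))%:E),
      (forall b g : R, 0 < b -> b < g ->
        Dbg b g =
        (Num.min
           (inf [set Lambda_plus b g t | t in `[eta_al_inv g b, psi_inv b]])
           (inf [set Lambda_minus b g t | t in `[eta_al_inv g b, psi_inv g[]))%:E),
      (forall g : R, 0 < g ->
        Dbg 0 g = (inf [set Lambda_minus 0 g t | t in `[0, psi_inv g[])%:E) &
      (forall b g : R, 0 < g -> g < b ->
        Dbg b g =
        (Num.min
           (inf [set Lambda_plus b g t | t in `[eta_al_inv b g, psi_inv b]])
           (inf [set Lambda_minus b g t | t in `[eta_al_inv b g, psi_inv g[]))%:E)].
Proof.
split.
- move=> b b0.
  have [/andP[e0 e1] eE] := eta_invP b0; have [/andP[p0 p1] pE] := psi_invP b0.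
  have ep : eta_inv b < psi_inv b.
    rewrite lt_psi_inv ?e0// -[ltRHS]eE ltrDl cphi_gt0// halfP// e0.
    exact: e1.
  have dom t : eta_inv b <= t -> t <= psi_inv b -> 0 < t < 2 * pi.
    by move=> l1 l2; rewrite (lt_le_trans e0 l1) (le_lt_trans l2 p1).
  apply: Dbg_branches => //.
  + move=> t; rewrite /= in_itv/= => /andP[l1 l2]; have tp := dom t l1 l2.
    have pb : cpsi (t / 2) <= b by rewrite -le_psi_inv.
    by apply: feasible_plus; rewrite -?eta_inv_disc.
  + move=> t; rewrite /= in_itv/= => /andP[l1 l2]; have tp := dom t l1 (ltW l2).
    have pb : cpsi (t / 2) < b by rewrite -lt_psi_inv.
    by apply: feasible_minus; rewrite -?eta_inv_disc// ltW.
  + move=> s t ft; have [d0 H] := feasible_branch ft; have [tp _ _] := ft.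
    case: H => -[pb ->]; [left|right]; split => //=; rewrite in_itv/=.
      by rewrite eta_inv_disc// d0 le_psi_inv.
    by rewrite eta_inv_disc ?(ltW pb)// d0 lt_psi_inv.
  + by exists (psi_inv b); rewrite /= in_itv/= lexx ltW.
  + by exists (eta_inv b); rewrite /= in_itv/= lexx.
- move=> b g b0 bg; have g0 := lt_trans b0 bg.
  have [/andP[e0 e1] eE] := eta_al_invP b0 bg; have [/andP[p0 p1] pE] := psi_invP b0.
  have [/andP[q0 q1] qE] := psi_invP g0.
  have pq : psi_inv b < psi_inv g by rewrite lt_psi_inv ?p0 ?pE.
  have dom t : eta_al_inv g b <= t -> t < psi_inv g -> 0 < t < 2 * pi.
    by move=> l1 l2; rewrite (lt_le_trans e0 l1) (lt_trans l2 q1).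
  have ep : eta_al_inv g b <= psi_inv b.
    rewrite eta_al_inv_disc ?p0 ?pE//.
    by rewrite /disc pE subrr mulr0 subr0 sqr_ge0.
  apply: Dbg_branches => //.
  + move=> t; rewrite /= in_itv/= => /andP[l1 l2].
    have tq := le_lt_trans l2 pq; have tp := dom t l1 tq.
    have pg : cpsi (t / 2) < g by rewrite -lt_psi_inv.
    by apply: feasible_plus; rewrite -?eta_al_inv_disc// -le_psi_inv.
  + move=> t; rewrite /= in_itv/= => /andP[l1 l2]; have tp := dom t l1 l2.
    have pg : cpsi (t / 2) < g by rewrite -lt_psi_inv.
    by apply: feasible_minus; rewrite -?eta_al_inv_disc.
  + move=> s t ft; have [d0 H] := feasible_branch ft; have [tp _ _] := ft.
    case: H => -[pb ->]; [left|right]; split => //=; rewrite in_itv/=.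
      by rewrite eta_al_inv_disc ?(le_lt_trans pb bg)// d0 le_psi_inv.
    by rewrite eta_al_inv_disc// d0 lt_psi_inv.
  + by exists (psi_inv b); rewrite /= in_itv/= lexx andbT.
  + by exists (eta_al_inv g b); rewrite /= in_itv/= lexx.
- move=> g g0; have [/andP[q0 q1] qE] := psi_invP g0.
  have LmE t : 0 < t < 2 * pi ->
      Lambda_minus 0 g t = cycloid_sqdist (S_minus 0 g t) (t / 2) / 2.
    by move=> tp; rewrite /Lambda_minus; case/andP: (tp) => t0 _; rewrite gt_eqF// Lam_rawE.
  have d0 t : 0 < t < 2 * pi -> cpsi (t / 2) < g -> 0 <= disc 0 g t.
    move=> tp pg; rewrite /disc subr0 addr_ge0 ?sqr_ge0// oppr_ge0.
    by rewrite mulr_le0_ge0 ?subr_le0 ?ltW// cpsi_gt0// halfP.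
  have d0E : ((2^-1)%:E * dH (0%R, 1%R) (0 + g * 0, 0)%R ^+ 2 = (2 : R)%:E)%E.
    by rewrite mulr0 addr0 dH_origin -EFin_expe -EFinM; congr EFin; field.
  apply: Dbg_inf.
  + move=> _ [t + <-]; rewrite /= in_itv/= le_eqVlt => /andP[/orP[/eqP<-|t0] tq].
      by rewrite Lambda_minus0.
    have tp : 0 < t < 2 * pi by rewrite t0 (lt_trans tq q1).
    by rewrite LmE// divr_ge0 ?cycloid_sqdist_ge0.
  + move=> _ [t + <-]; rewrite /= in_itv/= le_eqVlt => /andP[/orP[/eqP<-|t0] tq].
      by exists 0 => //; rewrite Lambda_minus0.
    have tp : 0 < t < 2 * pi by rewrite t0 (lt_trans tq q1).
    have pg : cpsi (t / 2) < g by rewrite -lt_psi_inv.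
    exists (S_minus 0 g t ^+ 2); first exact: sqr_ge0.
    by rewrite LmE// (feasible_dist (feasible_minus tp pg (d0 t tp pg))).
  + move=> w; rewrite le_eqVlt => /orP[/eqP<-|w0].
      by exists (Lambda_minus 0 g 0); [exists 0 => //; rewrite /= in_itv/= lexx|rewrite Lambda_minus0].
    have [|t ft] := @feasible_exists _ 0 g (Num.sqrt w) (sqrtr_ge0 _).
      by rewrite add0r sqr_sqrtr ?ltW// mulr_gt0.
    have := feasible_dist ft; rewrite sqr_sqrtr ?ltW// => ->.
    have [tp _ _] := ft; have [_ [[pb _]|[pg sE]]] := feasible_branch ft.
      by move: pb; rewrite leNgt cpsi_gt0// halfP.
    exists (Lambda_minus 0 g t); last by rewrite LmE// sE.
    by exists t => //; rewrite /= in_itv/= lt_psi_inv// pg andbT; case/andP: tp => /ltW.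
- move=> b g g0 gb; have b0 := lt_trans g0 gb.
  have [/andP[e0 e1] eE] := eta_al_invP g0 gb; have [/andP[p0 p1] pE] := psi_invP b0.
  have [/andP[q0 q1] qE] := psi_invP g0.
  have dom t : eta_al_inv b g <= t -> t <= psi_inv b -> 0 < t < 2 * pi.
    by move=> l1 l2; rewrite (lt_le_trans e0 l1) (le_lt_trans l2 p1).
  have qp : psi_inv g < psi_inv b by rewrite lt_psi_inv ?q0 ?qE.
  have ceq : cpsi (eta_al_inv b g / 2) < g.
    have ep := dom _ (lexx _) (ltW e1).
    have pb : cpsi (eta_al_inv b g / 2) < b by rewrite -lt_psi_inv.
    rewrite -[ltRHS]eE /ceta ltrDr divr_gt0 ?subr_gt0// exprn_gt0//.
    by rewrite cphi_gt0// halfP.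
  apply: Dbg_branches => //.
  + move=> t; rewrite /= in_itv/= => /andP[l1 l2]; have tp := dom t l1 l2.
    have pb : cpsi (t / 2) <= b by rewrite -le_psi_inv.
    apply: feasible_plus => //; rewrite discC.
    have [tb|tb] := ltP (cpsi (t / 2)) b; first by rewrite -eta_al_inv_disc.
    have -> : disc g b t = cphi (t / 2) ^+ 2.
      by rewrite /disc (_ : cpsi (t / 2) = b) ?subrr ?mul0r ?subr0//; apply/le_anti/andP.
    exact: sqr_ge0.
  + move=> t; rewrite /= in_itv/= => /andP[l1 l2].
    have tp := dom t l1 (ltW (lt_trans l2 qp)).
    have pg : cpsi (t / 2) < g by rewrite -lt_psi_inv.
    apply: feasible_minus => //; rewrite discC -eta_al_inv_disc//.
    exact: lt_trans pg gb.
  + move=> s t ft; have [d0 H] := feasible_branch ft; have [tp _ _] := ft.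
    rewrite discC in d0.
    case: H => -[pb ->]; [left|right]; split => //=; rewrite in_itv/=.
      rewrite le_psi_inv// pb andbT.
      have [tb|tb] := ltP (cpsi (t / 2)) b; first by rewrite eta_al_inv_disc.
      by apply: le_trans (ltW e1) _; rewrite ge_psi_inv.
    by rewrite eta_al_inv_disc// ?d0 ?lt_psi_inv// (lt_trans pb).
  + by exists (psi_inv b); rewrite /= in_itv/= lexx ltW.
  + exists (eta_al_inv b g); rewrite /= in_itv/= lexx/= lt_psi_inv//.
    exact: dom (lexx _) (ltW e1).
Qed.
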